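(* Let $n\ge 3$, $1\le i\le n-2$, and let $m,s,r,l,t$ be integers with $s,r,l,t\ge 0$; $m-s-r,\ m-s-l,\ m-r-t,\ m-l-t\ge 0$; $s+r+l+t-m\ge 0$. Then, with $h_n(i;m;s,r,l,t)$ the Haar state values on $\mathcal{O}(U_q(n))$ and $h(m;s,r,l,t)$ the Haar state values on $\mathcal{O}(U_q(3))$ defined in the context, $$\frac{h_n(i;m;s,r,l,t)}{h_n(i;m;0,m,m,0)}=\frac{h(m;s,r,l,t)}{h(m;0,m,m,0)},$$ and, with $\nu=s+r+l+t-m$, the right-hand side is given by $$\frac{h(m;s,r,l,t)}{h(m;0,m,m,0)}=\left(\sum_{j=0}^{\nu}(-1)^{j}q^{(\nu-j)(\nu-3j-1)+2j(s+t)}\frac{\binom{r}{j}_{q^2}\binom{l}{j}_{q^2}\binom{s}{\nu-j}_{q^2}\binom{t}{\nu-j}_{q^2}}{\binom{\nu}{j}_{q^2}}\right)\frac{(-1)^{r+l+\nu}\,q^{(2m+1)(l+r)+(\nu-2)m-2l^2-2r^2-rl+4st-3\nu s-3\nu t}}{\binom{m}{\nu,\;m-l-s,\;m-r-t}_{q^2}\binom{m}{\nu,\;m-r-s,\;m-l-t}_{q^2}}.$$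
   Context: Let $q$ be real, $q\notin\{0,1,-1\}$. $\mathcal{O}(Mat_q(n))$ is the unital associative $\mathbb{C}$-algebra generated by $x_{i,j}$, $1\le i,j\le n$, with relations, for $i<l$ and $j<k$: $x_{i,j}x_{l,j}=q\,x_{l,j}x_{i,j}$, $x_{i,j}x_{i,k}=q\,x_{i,k}x_{i,j}$, $x_{i,k}x_{l,j}=x_{l,j}x_{i,k}$, $x_{i,j}x_{l,k}=x_{l,k}x_{i,j}+(q-q^{-1})x_{i,k}x_{l,j}$. It is a bialgebra with algebra homomorphisms $\Delta(x_{i,j})=\sum_{p}x_{i,p}\otimes x_{p,j}$, $\varepsilon(x_{i,j})=\delta_{i,j}$. The quantum determinant $D_q=\sum_{\sigma\in\mathfrak S_n}(-q)^{\ell(\sigma)}x_{1,\sigma(1)}\cdots x_{n,\sigma(n)}$ ($\ell$ = number of inversions) is central. $\mathcal{O}(GL_q(n))$ is obtained by adjoining a central inverse $\mathrm{det}_q^{-1}$ of $D_q$, with $\Delta(\mathrm{det}_q^{-1})=\mathrm{det}_q^{-1}\otimes\mathrm{det}_q^{-1}$, $\varepsilon(\mathrm{det}_q^{-1})=1$; $\mathcal{O}(U_q(n))$ is this Hopf algebra with a compatible $*$-structure (not needed here). The Haar state $\mathbf h$ is the unique linear functional with $\mathbf h(1)=1$ and $(\mathrm{id}\otimes \mathbf h)\Delta(x)=\mathbf h(x)1=(\mathbf h\otimes\mathrm{id})\Delta(x)$ for all $x$. On $\mathcal{O}(U_q(3))$ write the generators as $\begin{bmatrix} x_{1,1} & x_{1,2}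 & x_{1,3} \\ x_{2,1} & x_{2,2} & x_{2,3} \\ x_{3,1} & x_{3,2} & x_{3,3} \end{bmatrix}=\begin{bmatrix} a & b & c \\ d & e & f \\ g & h & k \end{bmatrix}$ and let $h(m;s,r,l,t)$ be the value of the Haar state of $\mathcal{O}(U_q(3))$ on $$a^sb^{m-s-r}c^rd^{m-s-l}e^{s+r+l+t-m}f^{m-r-t}g^lh^{m-l-t}k^t\cdot\mathrm{det}_q^{-m}.$$ On $\mathcal{O}(U_q(n))$, for fixed $i$, label instead $$\begin{bmatrix} x_{i,n-1-i} & x_{i,n-i} & x_{i,n+1-i} \\ x_{i+1,n-1-i} & x_{i+1,n-i} & x_{i+1,n+1-i} \\ x_{i+2,n-1-i} & x_{i+2,n-i} & x_{i+2,n+1-i} \end{bmatrix}=\begin{bmatrix} a & b & c \\ d & e & f \\ g & h & k \end{bmatrix},$$ put $p_i^1=\prod_{j=1}^{i-1}x_{j,n+1-j}^m$ and $p_i^2=\prod_{j=i+3}^{n}x_{j,n+1-j}^m$ (empty products are $1$), and let $h_n(i;m;s,r,l,t)$ be the value of the Haar state of $\mathcal{O}(U_q(n))$ on $$p_i^1\cdot\left(a^sb^{m-s-r}c^rd^{m-s-l}e^{s+r+l+t-m}f^{m-r-t}g^lh^{m-l-t}k^t\right)\cdot p_i^2\cdot\mathrm{det}_q^{-m}.$$ Notation: $(x;p)_N=\prod_{i=0}^{N-1}(1-xp^i)$, $(x;p)_0=1$; $\binom{N}{j}_{q^2}=\frac{(q^2;q^2)_N}{(q^2;q^2)_j(q^2;q^2)_{N-j}}$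 for $0\le j\le N$ and $0$ for other integers $j$; for $N=N_1+N_2+N_3$ with $N_i\ge0$, $\binom{N}{N_1,N_2,N_3}_{q^2}=\frac{(q^2;q^2)_N}{(q^2;q^2)_{N_1}(q^2;q^2)_{N_2}(q^2;q^2)_{N_3}}$. *)

(* Defs.v *)
From HB Require Import structures.
From mathcomp Require Import all_fingroup.
From mathcomp Require Import all_boot all_order all_algebra.
From mathcomp Require Import boolp reals complex.
From mathcomp Require Import finmap monalg.

Set Implicit Arguments.
Unset Strict Implicit.
Unset Printing Implicit Defensive.

Import GRing.Theory.
Local Open Scope ring_scope.

(* The free algebra K<I>: the monoid algebra of the free monoid on I *)
Section FreeAlgebra.
Variables (K : fieldType) (I : choiceType).

Lemma malg_scaleAr (M : monomType) (c : K) (u v : {malg K[M]}) :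
  c *: (u * v) = u * (c *: v).
Proof.
apply/malgP => w.
rewrite mcoeffZ mcoeffMl (mcoeffMlw w (fsubset_refl _) (msuppZ_le c v)).
rewrite mulr_sumr; apply: eq_bigr => w1 _.
rewrite mulr_sumr; apply: eq_bigr => w2 _.
by rewrite mcoeffZ mulrCA mulrnAr.
Qed.

Definition freealg : predArgType := {malg K[{fmonom I}]}.
HB.instance Definition _ := GRing.Lmodule.on freealg.

(* The product of the monoid algebra, locked against unfolding *)
Definition fmul : freealg -> freealg -> freealg :=
  locked ( *%R : {malg K[{fmonom I}]} -> _ -> _).

Lemma fmulE (u v : {malg K[{fmonom I}]}) : fmul u v = u * v.
Proof. by rewrite /fmul -lock. Qed.

Lemma fmulA : associative fmul.
Proof. by move=> u v w; rewrite !fmulE; exact: mulrA. Qed.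
Lemma fmul1 : left_id (1 : {malg K[{fmonom I}]}) fmul.
Proof. by move=> u; rewrite fmulE; exact: mul1r. Qed.
Lemma f1mul : right_id (1 : {malg K[{fmonom I}]}) fmul.
Proof. by move=> u; rewrite fmulE; exact: mulr1. Qed.
Lemma fmulDl : left_distributive fmul +%R.
Proof. by move=> u v w; rewrite !fmulE; exact: mulrDl. Qed.
Lemma fmulDr : right_distributive fmul +%R.
Proof. by move=> u v w; rewrite !fmulE; exact: mulrDr. Qed.
HB.instance Definition _ := GRing.Zmodule_isNzRing.Build freealg
  fmulA fmul1 f1mul fmulDl fmulDr (oner_neq0 {malg K[{fmonom I}]}).

Lemma freealg_scaleAl (c : K) (u v : freealg) :
  c *: fmul u v = fmul (c *: u) v.
Proof. by rewrite !fmulE; exact: scalerAl. Qed.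
HB.instance Definition _ :=
  GRing.Lmodule_isLalgebra.Build K freealg freealg_scaleAl.

Lemma freealg_scaleAr (c : K) (u v : freealg) :
  c *: fmul u v = fmul u (c *: v).
Proof. by rewrite !fmulE; exact: malg_scaleAr. Qed.
HB.instance Definition _ :=
  GRing.Lalgebra_isAlgebra.Build K freealg freealg_scaleAr.

Definition word (w : {fmonom I}) : freealg := << w >>.
Definition gen (i : I) : freealg := word (fmu i).

Lemma word1 : word mone = 1. Proof. by []. Qed.

Lemma wordM w1 w2 : word w1 * word w2 = word (mmul w1 w2).
Proof.
change (fmul (word w1) (word w2) = word (mmul w1 w2)).
by rewrite fmulE [LHS]fgmulUU mulr1.
Qed.

Lemma freealg_ind (R : freealg -> Prop) :
    (forall w, R (word w)) -> R 0 ->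
    (forall c u v, R u -> R v -> R (c *: u + v)) -> forall u, R u.
Proof.
move=> Rw R0 RD u; rewrite [u]monalgE.
elim/big_ind: _ => // [x y Rx Ry|w _].
  by rewrite -[x]scale1r; apply: RD.
suff -> : << u@_w *g w >> = u@_w *: word w + 0 :> freealg by apply: RD.
by rewrite addr0; apply/malgP=> k; rewrite mcoeffZ !mcoeffU mulrnAr mulr1.
Qed.

Lemma mul_linl c (x u v : freealg) : x * (c *: u + v) = c *: (x * u) + x * v.
Proof. by rewrite mulrDr scalerAr. Qed.
Lemma mul_linr c (x u v : freealg) : (c *: u + v) * x = c *: (u * x) + v * x.
Proof. by rewrite mulrDl scalerAl. Qed.

Definition evalw (e : I -> K) (w : {fmonom I}) : K :=
  \prod_(i <- (w : seq I)) e i.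

Lemma evalw_mmorphism e : mmorphism (evalw e).
Proof.
by split=> [w1 w2|]; rewrite /evalw ?fm1 ?big_nil // fmM big_cat.
Qed.
HB.instance Definition _ e := isMultiplicative.Build _ _ _ (evalw_mmorphism e).

(* The algebra morphism K<I> -> K with gen i |-> e i *)
Definition evalF (e : I -> K) : freealg -> K := mmap idfun (evalw e).
HB.instance Definition _ e :=
  GRing.isZmodMorphism.Build freealg K (evalF e) (raddfB (mmap idfun (evalw e))).
Lemma evalF_monoid_morphism e : monoid_morphism (evalF e).
Proof.
split=> [|u v]; first exact: (rmorph1 (mmap idfun (evalw e))).
rewrite -[u * v]/(fmul u v) fmulE.
exact: (rmorphM (mmap idfun (evalw e))).
Qed.
HB.instance Definition _ e :=
  GRing.isMonoidMorphism.Build freealg K (evalF e) (evalF_monoid_morphism e).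
HB.instance Definition _ e :=
  GRing.isScalable.Build K freealg K _ (evalF e)
    (linearZ_LR (mmap idfun (evalw e))).

Lemma evalF_gen e i : evalF e (gen i) = e i.
Proof. by rewrite /evalF /gen /word mmapU /= mul1r /evalw fmU big_seq1. Qed.

End FreeAlgebra.

(* Algebras given by generators and relations [u = v].  MathComp algebras are *)
(* nonzero, so a presentation comes with scalar values for the generators     *)
(* that satisfy the relations; the values below are those of the counit.      *)
Record presentation (K : fieldType) := Presentation {
  pgens : choiceType;
  prels : freealg K pgens -> freealg K pgens -> Prop;
  paug : pgens -> K;
  paugP : forall u v, prels u v -> evalF paug u = evalF paug v }.

Section PresentedAlgebra.
Variables (K : fieldType) (P : presentation K).
Local Notation F := (freealg K (pgens P)).

(* The two-sided ideal generated by the differences [u - v] *)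
Inductive pideal : F -> Prop :=
| Pideal_rel u v : prels u v -> pideal (u - v)
| Pideal0 : pideal 0
| PidealD u v : pideal u -> pideal v -> pideal (u + v)
| PidealMl w u : pideal u -> pideal (w * u)
| PidealMr w u : pideal u -> pideal (u * w).

Definition pidealb (u : F) : bool := `[< pideal u >].

Lemma pidealb_zmod_closed : zmod_closed pidealb.
Proof.
split=> [|u v]; first exact/asboolP/Pideal0.
move=> /asboolP Iu /asboolP Iv; apply/asboolP; apply: PidealD => //.
by rewrite -mulN1r; apply: PidealMl.
Qed.
HB.instance Definition _ := GRing.isZmodClosed.Build F pidealb
  pidealb_zmod_closed.

Lemma pideal_eval u : pideal u -> evalF (@paug K P) u = 0.
Proof.
elim=> [{}u v /paugP e||{}u v _ eu _ ev|w {}u _ eu|w {}u _ eu].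
- by rewrite rmorphB /= e subrr.
- by rewrite rmorph0.
- by rewrite rmorphD /= eu ev addr0.
- by rewrite rmorphM /= eu mulr0.
- by rewrite rmorphM /= eu mul0r.
Qed.

Definition pidealZ := GRing.ZmodClosed.clone F pidealb _.
Definition presented : predArgType := Quotient.quot pidealZ.
HB.instance Definition _ := GRing.Zmodule.on presented.
HB.instance Definition _ := EqQuotient.on presented.

Definition ppi : F -> presented := \pi_presented%qT.

Lemma ppi_zmod_morphism : zmod_morphism ppi.
Proof. exact: (@pi_is_zmod_morphism _ _ _ (Quotient.quot pidealZ)). Qed.
HB.instance Definition _ := GRing.isZmodMorphism.Build F presented ppi
  ppi_zmod_morphism.

Lemma ppiK (x : presented) : ppi (repr x) = x.
Proof. exact: reprK. Qed.

Lemma ppiP u v : ppi u = ppi v <-> pideal (u - v).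
Proof.
have eqE : (ppi u == ppi v) = pidealb (u - v).
  by rewrite -[LHS](Quotient.idealrBE pidealZ).
split=> [e|Iuv]; first by apply/asboolP; rewrite -[asbool _]eqE e.
by apply/eqP; rewrite eqE; apply/asboolP.
Qed.

Lemma repr_ppi u : pideal (repr (ppi u) - u).
Proof. by apply/ppiP; rewrite ppiK. Qed.

Definition pone : presented := lift_cst presented 1.
Definition pmul : presented -> presented -> presented :=
  lift_op2 presented *%R.
Definition pscale (c : K) : presented -> presented :=
  lift_op1 presented ( *:%R c).

Lemma ppi1 : pone = ppi 1.
Proof. by rewrite /pone -lock. Qed.

Lemma ppiM u v : pmul (ppi u) (ppi v) = ppi (u * v).
Proof.
rewrite /pmul -lock; apply/ppiP.
move: (repr_ppi u) (repr_ppi v).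
move: (repr (ppi u)) (repr (ppi v)) => u' v' Iu Iv.
have -> : u' * v' - u * v = u' * (v' - v) + (u' - u) * v.
  by rewrite mulrBr mulrBl addrA subrK.
by apply: PidealD; [apply: PidealMl|apply: PidealMr].
Qed.

Lemma ppiZ c u : pscale c (ppi u) = ppi (c *: u).
Proof.
rewrite /pscale -lock; apply/ppiP.
move: (repr_ppi u); move: (repr _) => u' Iu.
have -> : c *: u' - c *: u = (c *: 1) * (u' - u).
  by rewrite -scalerBr -scalerAl mul1r.
exact: PidealMl.
Qed.

Lemma ppi_ind (Q : presented -> Prop) : (forall u, Q (ppi u)) -> forall x, Q x.
Proof. by move=> Qpi x; rewrite -(ppiK x). Qed.

Lemma pmulA : associative pmul.
Proof.
by elim/ppi_ind=> u; elim/ppi_ind=> v; elim/ppi_ind=> w; rewrite !ppiM mulrA.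
Qed.
Lemma pmul1 : left_id pone pmul.
Proof. by elim/ppi_ind=> u; rewrite ppi1 ppiM mul1r. Qed.
Lemma p1mul : right_id pone pmul.
Proof. by elim/ppi_ind=> u; rewrite ppi1 ppiM mulr1. Qed.
Lemma pmulDl : left_distributive pmul +%R.
Proof.
elim/ppi_ind=> u; elim/ppi_ind=> v; elim/ppi_ind=> w.
by rewrite -raddfD !ppiM mulrDl raddfD.
Qed.
Lemma pmulDr : right_distributive pmul +%R.
Proof.
elim/ppi_ind=> u; elim/ppi_ind=> v; elim/ppi_ind=> w.
by rewrite -raddfD !ppiM mulrDr raddfD.
Qed.
Lemma pone_neq0 : pone != 0.
Proof.
apply/eqP; rewrite ppi1 -(raddf0 ppi) => /ppiP; rewrite subr0 => /pideal_eval/eqP.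
by rewrite rmorph1 oner_eq0.
Qed.
HB.instance Definition _ := GRing.Zmodule_isNzRing.Build presented
  pmulA pmul1 p1mul pmulDl pmulDr pone_neq0.

Lemma pscaleA a b x : pscale a (pscale b x) = pscale (a * b) x.
Proof. by elim/ppi_ind: x => u; rewrite !ppiZ scalerA. Qed.
Lemma pscale1 : left_id 1 pscale.
Proof. by elim/ppi_ind=> u; rewrite ppiZ scale1r. Qed.
Lemma pscaleDr : right_distributive pscale +%R.
Proof.
move=> c; elim/ppi_ind=> u; elim/ppi_ind=> v.
by rewrite -raddfD !ppiZ scalerDr raddfD.
Qed.
Lemma pscaleDl x : {morph pscale^~ x : a b / a + b}.
Proof. by elim/ppi_ind: x => u a b; rewrite !ppiZ scalerDl raddfD. Qed.
HB.instance Definition _ := GRing.Zmodule_isLmodule.Build K presented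
  pscaleA pscale1 pscaleDr pscaleDl.

Lemma pscaleAl (c : K) (x y : presented) : c *: (x * y) = (c *: x) * y.
Proof.
elim/ppi_ind: x => u; elim/ppi_ind: y => v.
change (pscale c (pmul (ppi u) (ppi v)) = pmul (pscale c (ppi u)) (ppi v)).
by rewrite !(ppiM, ppiZ) scalerAl.
Qed.
HB.instance Definition _ := GRing.Lmodule_isLalgebra.Build K presented pscaleAl.

Lemma pscaleAr (c : K) (x y : presented) : c *: (x * y) = x * (c *: y).
Proof.
elim/ppi_ind: x => u; elim/ppi_ind: y => v.
change (pscale c (pmul (ppi u) (ppi v)) = pmul (ppi u) (pscale c (ppi v))).
by rewrite !(ppiM, ppiZ) scalerAr.
Qed.
HB.instance Definition _ := GRing.Lalgebra_isAlgebra.Build K presented pscaleAr.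

Lemma ppi_monoid_morphism : monoid_morphism ppi.
Proof. by split=> [|u v]; rewrite -?ppi1 -?ppiM. Qed.
HB.instance Definition _ := GRing.isMonoidMorphism.Build F presented ppi
  ppi_monoid_morphism.
Lemma ppi_scalable : scalable ppi.
Proof. by move=> c u; rewrite -ppiZ. Qed.
HB.instance Definition _ := GRing.isScalable.Build K F presented _ ppi
  ppi_scalable.

Definition pgen (i : pgens P) : presented := ppi (gen K i).

Definition pcounit (x : presented) : K := evalF (@paug K P) (repr x).

Lemma pcounit_ppi u : pcounit (ppi u) = evalF (@paug K P) u.
Proof.
by apply/eqP; rewrite -subr_eq0 -rmorphB; apply/eqP/pideal_eval/repr_ppi.
Qed.

Lemma pcounit_zmod_morphism : zmod_morphism pcounit.
Proof.
elim/ppi_ind=> u; elim/ppi_ind=> v.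
by rewrite -raddfB !pcounit_ppi rmorphB.
Qed.
HB.instance Definition _ := GRing.isZmodMorphism.Build presented K pcounit
  pcounit_zmod_morphism.
Lemma pcounit_monoid_morphism : monoid_morphism pcounit.
Proof.
split=> [|]; first by rewrite -(rmorph1 ppi) pcounit_ppi rmorph1.
by elim/ppi_ind=> u; elim/ppi_ind=> v; rewrite -rmorphM !pcounit_ppi rmorphM.
Qed.
HB.instance Definition _ := GRing.isMonoidMorphism.Build presented K pcounit
  pcounit_monoid_morphism.
Lemma pcounit_scalable : scalable_for *%R pcounit.
Proof.
move=> c; elim/ppi_ind=> u.
by rewrite -linearZ !pcounit_ppi linearZ.
Qed.
HB.instance Definition _ := GRing.isScalable.Build K presented K _ pcounit
  pcounit_scalable.

Lemma pcounit_gen i : pcounit (pgen i) = paug i.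
Proof. by rewrite pcounit_ppi evalF_gen. Qed.

End PresentedAlgebra.

(* The tensor product A (x) B of two algebras, presented by the symbols a (x) *)
(* b subject to bilinearity, 1 (x) 1 = 1 and (a (x) b)(a' (x) b') = aa' (x)   *)
(* bb'; in particular it is spanned by the a (x) b.  [tens_lift] is the       *)
(* universal property of A (x) B as a vector space.                           *)
Section Tensor.

Variables (K : fieldType) (P Q : presentation K).
Local Notation A := (presented P).
Local Notation B := (presented Q).


Definition tens_gens : choiceType := (A * B)%type.
Local Notation F := (freealg K tens_gens).
Local Notation tgen a b := (gen K ((a, b) : tens_gens)).
Local Notation word := (@word K tens_gens).

Variant tens_rels : F -> F -> Prop :=
| Tens_addl a a' b : tens_rels (tgen (a + a') b) (tgen a b + tgen a' b)
| Tens_addr a b b' : tens_rels (tgen a (b + b')) (tgen a b + tgen a b')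
| Tens_scalel c a b : tens_rels (tgen (c *: a) b) (c *: tgen a b)
| Tens_scaler c a b : tens_rels (tgen a (c *: b)) (c *: tgen a b)
| Tens_one : tens_rels (tgen 1 1) 1
| Tens_mul a a' b b' :
    tens_rels (tgen a b * tgen a' b') (tgen (a * a') (b * b')).

Definition tens_aug (ab : tens_gens) : K := pcounit ab.1 * pcounit ab.2.

Lemma tens_augP u v : tens_rels u v -> evalF tens_aug u = evalF tens_aug v.
Proof.
case=> [a a' b|a b b'|c a b|c a b||a a' b b'].
- by rewrite raddfD /= !evalF_gen /tens_aug /= raddfD mulrDl.
- by rewrite raddfD /= !evalF_gen /tens_aug /= raddfD mulrDr.
- by rewrite linearZ /= !evalF_gen /tens_aug /= linearZ /= mulrA.
- by rewrite linearZ /= !evalF_gen /tens_aug /= linearZ /= mulrCA.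
- by rewrite rmorph1 evalF_gen /tens_aug /= !rmorph1 mulr1.
- by rewrite rmorphM /= !evalF_gen /tens_aug /= !rmorphM /= mulrACA.
Qed.

Definition tens_presentation : presentation K := Presentation tens_augP.
Definition tens : predArgType := presented tens_presentation.
HB.instance Definition _ := GRing.Algebra.on tens.

Definition tensor (a : A) (b : B) : tens := @pgen K tens_presentation (a, b).

Section Lift.
Variables (V : lmodType K).

Definition wlift (f : A -> B -> V) (w : {fmonom tens_gens}) : V :=
  f (\prod_(ab <- (w : seq _)) ab.1) (\prod_(ab <- (w : seq _)) ab.2).
Definition flift (f : A -> B -> V) (u : F) : V :=
  \sum_(w <- msupp u) u@_w *: wlift f w.
Definition tens_lift (f : A -> B -> V) (x : tens) : V := flift f (repr x).

Lemma fliftEw f (d : {fset {fmonom tens_gens}}) u :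
  (msupp u `<=` d)%fset -> flift f u = \sum_(w <- d) u@_w *: wlift f w.
Proof.
move=> le; rewrite /flift (big_fset_incl _ le) //= => w _ /mcoeff_outdom ->.
by rewrite scale0r.
Qed.

Lemma flift_linear f : linear (flift f).
Proof.
move=> c u v; pose d := (msupp u `|` msupp v)%fset.
rewrite (@fliftEw f d (c *: u + v)); last first.
  apply: fsubset_trans (msuppD_le _ _) _; apply: fsetSU; exact: msuppZ_le.
rewrite (@fliftEw f d u) ?fsubsetUl // (@fliftEw f d v) ?fsubsetUr //.
rewrite scaler_sumr -big_split /=; apply: eq_bigr => w _.
by rewrite mcoeffD mcoeffZ scalerDl scalerA.
Qed.

Lemma flift0 f : flift f 0 = 0.
Proof. by rewrite /flift msupp0 big_seq_fset0. Qed.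
Lemma fliftD f u v : flift f (u + v) = flift f u + flift f v.
Proof. by rewrite -[u]scale1r flift_linear !scale1r. Qed.
Lemma fliftZ f c u : flift f (c *: u) = c *: flift f u.
Proof. by rewrite -[c *: u]addr0 flift_linear flift0 addr0. Qed.

Lemma flift_mono f w : flift f (word w) = wlift f w.
Proof.
by rewrite /word (fliftEw f msuppU_le) big_seq_fset1 mcoeffUU scale1r.
Qed.

Lemma flift_gen f a b : flift f (tgen a b) = f a b.
Proof. by rewrite flift_mono /wlift fmU !big_seq1. Qed.

Definition wshift (f : A -> B -> V) (w1 w2 : {fmonom tens_gens}) a b : V :=
  f (\prod_(ab <- (w1 : seq _)) ab.1 * a * \prod_(ab <- (w2 : seq _)) ab.1)
    (\prod_(ab <- (w1 : seq _)) ab.2 * b * \prod_(ab <- (w2 : seq _)) ab.2).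

Lemma flift_mulw f w1 w2 u :
  flift f (word w1 * u * word w2) = flift (wshift f w1 w2) u.
Proof.
elim/freealg_ind: u => [w||c u v eu ev].
- by rewrite !wordM !flift_mono /wshift /wlift !fmM !big_cat.
- by rewrite mulr0 mul0r !flift0.
by rewrite mul_linl mul_linr 2!flift_linear; congr (_ *: _ + _).
Qed.

Lemma flift_rels (f : {bilinear A -> B -> V}) w1 w2 u v :
  tens_rels u v ->
  flift f (word w1 * u * word w2) = flift f (word w1 * v * word w2).
Proof.
rewrite [LHS]flift_mulw [RHS]flift_mulw; set g := wshift f w1 w2.
have gDl a a' b : g (a + a') b = g a b + g a' b.
  by rewrite /g /wshift mulrDr mulrDl linearDl.
have gDr a b b' : g a (b + b') = g a b + g a b'.
  by rewrite /g /wshift mulrDr mulrDl linearDr.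
have gZl c a b : g (c *: a) b = c *: g a b.
  by rewrite /g /wshift -scalerAr -scalerAl linearZl_LR.
have gZr c a b : g a (c *: b) = c *: g a b.
  by rewrite /g /wshift -scalerAr -scalerAl linearZr_LR.
case=> [a a' b|a b b'|c a b|c a b||a a' b b'].
- by rewrite fliftD !flift_gen.
- by rewrite fliftD !flift_gen.
- by rewrite fliftZ !flift_gen.
- by rewrite fliftZ !flift_gen.
- by rewrite flift_gen -word1 flift_mono /wlift fm1 !big_nil.
by rewrite wordM flift_gen flift_mono /wlift fmM !fmU !big_cat /= !big_seq1.
Qed.

Lemma flift_ideal (f : {bilinear A -> B -> V}) (u : F) :
  @pideal K tens_presentation u -> flift f u = 0.
Proof.
move=> Iu; suff: forall v w, flift f (v * u * w) = 0.
  by move=> /(_ 1 1); rewrite mul1r mulr1.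
have lin0 c (x y : V) : x = 0 -> y = 0 -> c *: x + y = 0.
  by move=> -> ->; rewrite scaler0 addr0.
have sub0 (x y : V) : x = y -> -1 *: y + x = 0.
  by move=> ->; rewrite scaleN1r addNr.
elim: Iu => [{}u u' r||{}u u' _ IHu _ IHu'|x {}u _ IHu|x {}u _ IHu] v w.
- elim/freealg_ind: v => [w1||c v v' ev ev'].
  + elim/freealg_ind: w => [w2||c w w' ew ew'].
    * rewrite -[u - u']addrC -scaleN1r mul_linl mul_linr flift_linear.
      exact/sub0/flift_rels.
    * by rewrite mulr0 flift0.
    * by rewrite mul_linl flift_linear; apply: lin0.
  + by rewrite mul0r mul0r flift0.
  + by rewrite 2!mul_linr flift_linear; apply: lin0.
- by rewrite mulr0 mul0r flift0.
- by rewrite mulrDr mulrDl fliftD -[X in X + _]scale1r; apply: lin0.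
- by rewrite mulrA; apply: IHu.
- by rewrite -mulrA -mulrA mulrA; apply: IHu.
Qed.

Lemma tens_lift_ppi (f : {bilinear A -> B -> V}) u :
  tens_lift f (@ppi K tens_presentation u) = flift f u.
Proof.
have := flift_ideal f (repr_ppi (P := tens_presentation) u).
rewrite addrC -scaleN1r flift_linear scaleN1r addrC => /eqP.
by rewrite subr_eq0 => /eqP.
Qed.

Lemma tens_liftE (f : {bilinear A -> B -> V}) a b :
  tens_lift f (tensor a b) = f a b.
Proof. by rewrite tens_lift_ppi flift_gen. Qed.

Lemma tens_lift_linear (f : {bilinear A -> B -> V}) : linear (tens_lift f).
Proof.
move=> c; elim/ppi_ind=> u; elim/ppi_ind=> v.
by rewrite -linearP !tens_lift_ppi flift_linear.
Qed.
HB.instance Definition _ (f : {bilinear A -> B -> V}) :=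
  GRing.isLinear.Build K tens V _ (tens_lift f) (tens_lift_linear f).

End Lift.
End Tensor.

(* For h : A -> K linear, the maps id (x) h and h (x) id from A (x) A to A *)
Section Slices.
Variables (K : fieldType) (P : presentation K).
Local Notation A := (presented P).
Variable h : {scalar A}.

Definition id_scal (a b : A) : A := h b *: a.
Definition scal_id (a b : A) : A := h a *: b.

Lemma id_scal_bilinear : bilinear_for *:%R *:%R id_scal.
Proof.
split=> [b c a a'|a c b b'] /=; rewrite /id_scal.
  by rewrite scalerDr !scalerA mulrC.
by rewrite linearP scalerDl scalerA.
Qed.
HB.instance Definition _ :=
  bilinear_isBilinear.Build K A A A _ _ id_scal id_scal_bilinear.

Lemma scal_id_bilinear : bilinear_for *:%R *:%R scal_id.
Proof.
split=> [b c a a'|a c b b'] /=; rewrite /scal_id.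
  by rewrite linearP scalerDl scalerA.
by rewrite scalerDr !scalerA mulrC.
Qed.
HB.instance Definition _ :=
  bilinear_isBilinear.Build K A A A _ _ scal_id scal_id_bilinear.

Definition id_tens_h : tens P P -> A := tens_lift id_scal.
Definition h_tens_id : tens P P -> A := tens_lift scal_id.

Lemma id_tens_hE a b : id_tens_h (tensor a b) = h b *: a.
Proof. exact: (tens_liftE id_scal). Qed.
Lemma h_tens_idE a b : h_tens_id (tensor a b) = h a *: b.
Proof. exact: (tens_liftE scal_id). Qed.

End Slices.

Definition invs n (s : 'S_n) : nat :=
  #|[set p : 'I_n * 'I_n | (p.1 < p.2)%N && (s p.2 < s p.1)%N]|.

(* \prod_(i < n) is taken in increasing order of i *)
Definition qdet (K : fieldType) (A : algType K) (q : K) n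
    (X : 'I_n -> 'I_n -> A) : A :=
  \sum_(s : 'S_n) (- q) ^+ invs s *: \prod_(i < n) X i (s i).

Section QuantumGL.
Variables (K : fieldType) (n : nat) (q : K).

(* Generator [Some (i, j)] is x_{i+1,j+1} and [None] is the inverse of D_q *)
Definition OGL_gens : choiceType := option ('I_n * 'I_n)%type.
Local Notation F := (freealg K OGL_gens).
Local Notation X := (fun i j => gen K (Some (i, j) : OGL_gens)).
Local Notation dinv := (gen K (None : OGL_gens)).

Variant OGL_rels : F -> F -> Prop :=
| OGL_col (i l j : 'I_n) : (i < l)%N ->
    OGL_rels (X i j * X l j) (q *: (X l j * X i j))
| OGL_row (i j k : 'I_n) : (j < k)%N ->
    OGL_rels (X i j * X i k) (q *: (X i k * X i j))
| OGL_anti (i l j k : 'I_n) : (i < l)%N -> (j < k)%N ->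
    OGL_rels (X i k * X l j) (X l j * X i k)
| OGL_diag (i l j k : 'I_n) : (i < l)%N -> (j < k)%N ->
    OGL_rels (X i j * X l k) (X l k * X i j + (q - q^-1) *: (X i k * X l j))
| OGL_dinv_central (i j : 'I_n) : OGL_rels (X i j * dinv) (dinv * X i j)
| OGL_dinvl : OGL_rels (dinv * qdet q X) 1
| OGL_dinvr : OGL_rels (qdet q X * dinv) 1.

Definition OGL_aug (g : OGL_gens) : K :=
  if g is Some (i, j) then (i == j)%:R else 1.

Lemma OGL_aug_qdet : evalF OGL_aug (qdet q X) = 1.
Proof.
have evE (s : 'S_n) :
    evalF OGL_aug ((- q) ^+ invs s *: \prod_(i < n) X i (s i)) =
    (- q) ^+ invs s * \prod_(i < n) (i == s i)%:R.
  rewrite linearZ /= rmorph_prod /=; congr (_ * _).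
  by apply: eq_bigr => i _; rewrite evalF_gen.
rewrite raddf_sum /= (eq_bigr _ (fun s _ => evE s)) (bigD1 1%g) //=.
rewrite [X in _ + X]big1 => [|s]; last first.
  apply: contraNeq => nz; apply/eqP/perm.permP => i; rewrite perm1.
  apply/eqP; apply: contraNT nz => nsi.
  by rewrite (bigD1 i) //= [i == _]eq_sym (negPf nsi) mul0r mulr0.
have -> : invs (1%g : 'S_n) = 0%N.
  apply/eqP; rewrite cards_eq0; apply/eqP/setP => p; rewrite !inE !perm1.
  by apply/negP => /andP[/ltnW]; rewrite leqNgt => /negPf ->.
by rewrite expr0 mul1r big1 ?addr0 // => i _; rewrite perm1 eqxx.
Qed.

Lemma OGL_augP u v : OGL_rels u v -> evalF OGL_aug u = evalF OGL_aug v.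
Proof.
have ltF (i j : 'I_n) : (i < j)%N -> (i == j) = false.
  by move=> lt_ij; apply/negP => /eqP e; rewrite e ltnn in lt_ij.
case=> [i l j lt_il|i j k lt_jk|i l j k lt_il lt_jk|i l j k lt_il lt_jk|i j||].
- rewrite linearZ /= !rmorphM /= !evalF_gen /=.
  have [e|_] := eqVneq i j; last by rewrite mul0r mulr0 mulr0.
  by rewrite [l == j]eq_sym -e ltF // !(mulr0, mul0r).
- rewrite linearZ /= !rmorphM /= !evalF_gen /=.
  have [e|_] := eqVneq i j; last by rewrite mul0r mulr0 mulr0.
  by rewrite e ltF // !(mulr0, mul0r).
- by rewrite !rmorphM /= !evalF_gen /= mulrC.
- have z : (i == k)%:R * (l == j)%:R = 0 :> K.
    have [e1|_] := eqVneq i k; last by rewrite mul0r.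
    have [e2|_] := eqVneq l j; last by rewrite mulr0.
    rewrite e2 in lt_il; rewrite -e1 in lt_jk.
    by have := ltn_trans lt_il lt_jk; rewrite ltnn.
  rewrite raddfD /= linearZ /= !rmorphM /= !evalF_gen /= z mulr0 addr0.
  exact: mulrC.
- by rewrite !rmorphM /= mulrC.
- by rewrite rmorphM /= OGL_aug_qdet evalF_gen mulr1 rmorph1.
- by rewrite rmorphM /= OGL_aug_qdet evalF_gen mulr1 rmorph1.
Qed.

Definition OGL_presentation : presentation K := Presentation OGL_augP.

(* O(GL_q(n)) *)
Definition OGL : predArgType := presented OGL_presentation.
HB.instance Definition _ := GRing.Algebra.on OGL.

Definition OGL_x (i j : 'I_n) : OGL :=
  @pgen K OGL_presentation (Some (i, j)).
Definition OGL_detinv : OGL := @pgen K OGL_presentation None.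

(* x_{i,j} with the 1-based numbering; meaningful for 1 <= i, j <= n *)
Definition xgen (i j : nat) : OGL :=
  if (insub i.-1, insub j.-1) is (Some i0, Some j0) then OGL_x i0 j0 else 0.

Definition OGL2 : predArgType := tens OGL_presentation OGL_presentation.
HB.instance Definition _ := GRing.Algebra.on OGL2.

(* Delta is determined by these values, since the generators generate *)
Definition is_comul (Delta : {lrmorphism OGL -> OGL2}) : Prop :=
  (forall i j, Delta (OGL_x i j) = \sum_p tensor (OGL_x i p) (OGL_x p j)) /\
  Delta OGL_detinv = tensor OGL_detinv OGL_detinv.

Definition is_haar (h : {scalar OGL}) : Prop :=
  h 1 = 1 /\
  exists2 Delta : {lrmorphism OGL -> OGL2}, is_comul Delta &
    forall x, id_tens_h h (Delta x) = h x *: 1 /\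
              h_tens_id h (Delta x) = h x *: 1.

End QuantumGL.

(* The exponents below are nonnegative in the range where [mono9] is used, so *)
(* the subtractions on nat are exact there.                                   *)
Definition mono9 (K : fieldType) (A : algType K) (a b c d e f g h k : A)
    (m s r l t : nat) : A :=
  a ^+ s * b ^+ (m - s - r) * c ^+ r *
  d ^+ (m - s - l) * e ^+ (s + r + l + t - m) * f ^+ (m - r - t) *
  g ^+ l * h ^+ (m - l - t) * k ^+ t.

Definition mono3 (K : fieldType) (q : K) (m s r l t : nat) : OGL 3 q :=
  let x := xgen 3 q in
  mono9 (x 1 1) (x 1 2) (x 1 3)
        (x 2 1) (x 2 2) (x 2 3)
        (x 3 1) (x 3 2) (x 3 3) m s r l t * OGL_detinv 3 q ^+ m.

(* j is the 1-based column n - 1 - i of the labelled 3 x 3 block; both         *)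
(* products over u are taken in increasing order.                             *)
Definition monon (K : fieldType) (q : K) (n i m s r l t : nat) : OGL n q :=
  let x := xgen n q in
  let j := (n - 1 - i)%N in
  (\prod_(1 <= u < i) x u (n + 1 - u)%N ^+ m) *
  mono9 (x i     j) (x i     j.+1) (x i     j.+2)
        (x i.+1  j) (x i.+1  j.+1) (x i.+1  j.+2)
        (x i.+2  j) (x i.+2  j.+1) (x i.+2  j.+2) m s r l t *
  (\prod_(i + 3 <= u < n.+1) x u (n + 1 - u)%N ^+ m) *
  OGL_detinv n q ^+ m.

Section QBinomials.
Variables (K : fieldType) (q : K).

Definition qpoch (x p : K) (N : nat) : K := \prod_(i < N) (1 - x * p ^+ i).

Definition qbin2 (N j : nat) : K :=
  if (j <= N)%N then
    qpoch (q ^+ 2) (q ^+ 2) N /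
      (qpoch (q ^+ 2) (q ^+ 2) j * qpoch (q ^+ 2) (q ^+ 2) (N - j))
  else 0.

Definition qmultinom2 (N N1 N2 N3 : nat) : K :=
  qpoch (q ^+ 2) (q ^+ 2) N /
    (qpoch (q ^+ 2) (q ^+ 2) N1 * qpoch (q ^+ 2) (q ^+ 2) N2 *
     qpoch (q ^+ 2) (q ^+ 2) N3).

End QBinomials.

(* Main.v *)
Require Import Defs.
From HB Require Import structures.
From mathcomp Require Import all_fingroup.
From mathcomp Require Import all_boot all_order all_algebra.
From mathcomp Require Import boolp reals complex.
From mathcomp Require Import finmap monalg.
From mathcomp Require Import zify ring.

(** Twisting the Haar state by det_q^-m gives a functional that is invariant
    under slices of the coproduct.  Slicing with a matrix coefficient of a
    two-dimensional upper triangular representation of O(GL_q(n)) turns this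
    invariance into a linear relation, for each pair of adjacent columns,
    between the values on ordered monomials; slicing with characters shows that
    only monomials with all column sums m contribute.  These relations determine
    the values on monomials with all row sums m from the value on the m-th power
    of the antidiagonal: starting from the first row, each row is moved to the
    antidiagonal one unit at a time.  Since D_q^m lies in the span of such
    monomials and h(1) = 1, the antidiagonal value is nonzero.  The relations
    for columns of a 3 x 3 block only involve the block, so for every n the
    ratio is the one solution of the 3 x 3 relations.  That solution is the
    quantum analogue of the coefficient of a monomial in det^m, a sum over the
    multiplicities of the six permutations of three letters; it satisfies the
    relations because each q-integer splits along two permutations, and the
    resulting six pieces cancel in pairs related by the transposition of the two
    columns. *)

Set Implicit Arguments.
Unset Strict Implicit.
Unset Printing Implicit Defensive.

Import GRing.Theory Num.Theory.
Local Open Scope ring_scope.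

(** * Representations of presented algebras and slices of the Haar state *)

Section Evaluation.
Variables (K : fieldType) (I : choiceType) (B : algType K) (e : I -> B).

Definition evalBw (w : {fmonom I}) : B := \prod_(i <- (w : seq I)) e i.

Lemma evalBw_mmorphism : mmorphism evalBw.
Proof.
by split=> [w1 w2|]; rewrite /evalBw ?fm1 ?big_nil // fmM big_cat.
Qed.
HB.instance Definition _ := isMultiplicative.Build _ _ _ evalBw_mmorphism.

Definition evalB (u : freealg K I) : B := mmap (in_alg B) evalBw u.
HB.instance Definition _ :=
  GRing.isZmodMorphism.Build (freealg K I) B evalB
    (raddfB (mmap (in_alg B) evalBw)).

(** In a noncommutative target, multiplicativity of [mmap] requires the coefficients to commute with
    the values of words; scalars do. *)
Lemma evalB_monoid_morphism : monoid_morphism evalB.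
Proof.
have cm (g : {malg K[{fmonom I}]}) m m' :
    GRing.comm (in_alg B g@_m) (evalBw m').
  by rewrite /GRing.comm /= -scalerAl mul1r -scalerAr mulr1.
have [M M1] := commr_mmap_is_multiplicative cm.
split; first exact: M1.
move=> u v; rewrite -[u * v]/(fmul u v) fmulE; exact: M.
Qed.
HB.instance Definition _ :=
  GRing.isMonoidMorphism.Build (freealg K I) B evalB evalB_monoid_morphism.

Lemma evalB_scalable : scalable evalB.
Proof. by move=> c u; rewrite /evalB mmapZ /= -scalerAl mul1r. Qed.
HB.instance Definition _ :=
  GRing.isScalable.Build K (freealg K I) B _ evalB evalB_scalable.

Lemma evalB_gen i : evalB (gen K i) = e i.
Proof.
by rewrite /evalB /gen /word mmapU /= scale1r mul1r /evalBw fmU big_seq1.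
Qed.

End Evaluation.

Section Representation.
Variables (K : fieldType) (P : presentation K) (B : algType K).
Variable e : pgens P -> B.
Hypothesis eP : forall u v, prels u v -> evalB e u = evalB e v.

Lemma pideal_evalB u : pideal u -> evalB e u = 0.
Proof.
elim=> [{}u v /eP E||{}u v _ eu _ ev|w {}u _ eu|w {}u _ eu].
- by rewrite rmorphB /= E subrr.
- by rewrite rmorph0.
- by rewrite rmorphD /= eu ev addr0.
- by rewrite rmorphM /= eu mulr0.
- by rewrite rmorphM /= eu mul0r.
Qed.

Definition prep (x : presented P) : B := evalB e (repr x).

Lemma prep_ppi u : prep (ppi u) = evalB e u.
Proof.
by apply/eqP; rewrite -subr_eq0 -rmorphB; apply/eqP/pideal_evalB/repr_ppi.
Qed.

(** The universal property of generators and relations, for targets such as matrix algebras that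
    [evalF] with its scalar values does not reach. *)
Lemma prep_exists : exists rho : {lrmorphism presented P -> B},
  forall i, rho (pgen i) = e i.
Proof.
have Za : zmod_morphism prep.
  by elim/ppi_ind=> u; elim/ppi_ind=> v; rewrite -raddfB !prep_ppi rmorphB.
have Mm : monoid_morphism prep.
  split=> [|]; first by rewrite -(rmorph1 (@ppi K P)) prep_ppi rmorph1.
  by elim/ppi_ind=> u; elim/ppi_ind=> v; rewrite -rmorphM !prep_ppi rmorphM.
have Sc : scalable prep.
  by move=> c; elim/ppi_ind=> u; rewrite -linearZ !prep_ppi linearZ.
pose pa := GRing.isZmodMorphism.Build _ _ prep Za.
pose pm := GRing.isMonoidMorphism.Build _ _ prep Mm.
pose ps := GRing.isScalable.Build K _ _ _ prep Sc.
pose rho : {lrmorphism presented P -> B} :=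
  HB.pack prep pa pm ps.
by exists rho => i; rewrite /= prep_ppi evalB_gen.
Qed.

End Representation.

Lemma mulmx_scalarE (R : nzRingType) d (M : 'M[R]_d.+1) c a b :
  (M * c%:M) a b = M a b * c.
Proof.
rewrite mxE (bigD1 b) //= mxE eqxx mulr1n big1 ?addr0 // => b' /negPf b'b.
by rewrite mxE b'b mulr0.
Qed.

Section Slice.
Variables (K : fieldType) (P : presentation K).
Local Notation A := (presented P).
Local Notation T := (tens P P).

Lemma tensor11 : tensor 1 1 = 1 :> T.
Proof.
apply: etrans (rmorph1 (@ppi K (tens_presentation P P))).
by apply/ppiP; apply: Pideal_rel; exact: Tens_one.
Qed.

Lemma tensorM (a a' b b' : A) :
  tensor a b * tensor a' b' = tensor (a * a') (b * b') :> T.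
Proof.
apply: etrans (esym (rmorphM (@ppi K (tens_presentation P P)) _ _)) _.
by apply/ppiP; apply: Pideal_rel; exact: Tens_mul.
Qed.

(** A word in the symbols a (x) b collapses to one pure tensor by [tensorM], the empty word being 1
    (x) 1. *)
Lemma tens_ind (R : T -> Prop) :
    (forall a b, R (tensor a b)) -> R 0 ->
    (forall c u v, R u -> R v -> R (c *: u + v)) -> forall z, R z.
Proof.
move=> Rt R0 RD; elim/ppi_ind=> u.
elim/freealg_ind: u => [w||c u v Ru Rv]; last 2 first.
- by rewrite raddf0.
- by rewrite linearP; apply: RD.
suff [a [b ->]] : exists a b, ppi (word K w) = tensor a b :> T by apply: Rt.
case: w => s; elim: s => [|[a b] s [a' [b' IH]]].
  exists 1, 1; rewrite tensor11 -(rmorph1 (@ppi K (tens_presentation P P))).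
  by congr (ppi (word _ _)); rewrite /mone /= fmoneE.
exists (a * a'), (b * b'); rewrite -tensorM -IH /tensor /pgen.
rewrite -[LHS]/(@ppi K (tens_presentation P P) _).
rewrite -(rmorphM (@ppi K (tens_presentation P P))).
by congr ppi; rewrite /gen wordM; congr word; rewrite /mmul /= fmmulE fmuE.
Qed.

HB.instance Definition _ (h : {scalar A}) :=
  GRing.isLinear.Build K T A _ (id_tens_h h) (tens_lift_linear (id_scal h)).
HB.instance Definition _ (h : {scalar A}) :=
  GRing.isLinear.Build K T A _ (h_tens_id h) (tens_lift_linear (scal_id h)).

Section Coefficient.
Variables (d : nat) (rho : {lrmorphism A -> 'M[K]_d.+1}).

Definition mxcoef (a b : 'I_d.+1) (x : A) : K := rho x a b.
Lemma mxcoef_linear a b : linear_for *%R (mxcoef a b).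
Proof. by move=> c x y; rewrite /mxcoef linearP !mxE. Qed.
HB.instance Definition _ a b :=
  GRing.isLinear.Build K A K _ (mxcoef a b) (mxcoef_linear a b).

Lemma mxcoefM a b x y :
  mxcoef a b (x * y) = \sum_c mxcoef a c x * mxcoef c b y.
Proof. by rewrite /mxcoef rmorphM /= mxE. Qed.

Lemma id_tens_mxcoef a b x y :
  id_tens_h (mxcoef a b) (tensor x y) = mxcoef a b y *: x.
Proof. exact: id_tens_hE. Qed.

Variable Delta : {lrmorphism A -> T}.

(** This is (id (x) [rho]) Delta, with values in matrices over the algebra. *)
Definition slice (x : A) : 'M[A]_d.+1 :=
  \matrix_(a, b) id_tens_h (mxcoef a b) (Delta x).

Lemma slice_tensorM a b (z z' : T) :
  id_tens_h (mxcoef a b) (z * z') =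
  \sum_c id_tens_h (mxcoef a c) z * id_tens_h (mxcoef c b) z'.
Proof.
elim/tens_ind: z => [x y||k u v IHu IHv].
- elim/tens_ind: z' => [x' y'||k u v IHu IHv].
  + rewrite tensorM id_tens_mxcoef mxcoefM scaler_suml.
    apply: eq_bigr => c _; rewrite !id_tens_mxcoef.
    by rewrite -scalerAl -scalerAr scalerA.
  + by rewrite mulr0 linear0 big1 // => c _; rewrite linear0 mulr0.
  + rewrite mulrDr -scalerAr linearP /= IHu IHv scaler_sumr -big_split.
    by apply: eq_bigr => c _; rewrite linearP /= mulrDr scalerAr.
- by rewrite mul0r linear0 big1 // => c _; rewrite linear0 mul0r.
- rewrite mulrDl -scalerAl linearP /= IHu IHv scaler_sumr -big_split.
  by apply: eq_bigr => c _; rewrite linearP /= mulrDl scalerAl.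
Qed.

Lemma sliceM x y : slice (x * y) = slice x * slice y.
Proof.
apply/matrixP => a b; rewrite !mxE rmorphM /= slice_tensorM.
by apply: eq_bigr => c _; rewrite !mxE.
Qed.

Lemma slice1 : slice 1 = 1.
Proof.
apply/matrixP => a b; rewrite !mxE rmorph1 -tensor11 id_tens_mxcoef.
by rewrite /mxcoef rmorph1 !mxE; case: eqP; rewrite ?scale1r ?scale0r.
Qed.

Lemma slice_comul (J : finType) (u v : J -> A) y a b :
  Delta y = \sum_p tensor (u p) (v p) ->
  slice y a b = \sum_p rho (v p) a b *: u p.
Proof.
move=> yE; rewrite mxE yE linear_sum; apply: eq_bigr => p _.
exact: id_tens_mxcoef.
Qed.

(** The slice of such a [g] is the scalar matrix of [c *: g], and right multiplication by a scalar
    matrix acts entrywise. It is meant for the inverse determinant. *)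
Lemma slice_grouplike c g y k a b :
  Delta g = tensor g g -> rho g = c%:M ->
  slice (y * g ^+ k) a b = c ^+ k *: (slice y a b * g ^+ k).
Proof.
move=> gE rg; have sg : slice g = (c *: g)%:M.
  apply/matrixP => a' b'; rewrite mxE gE id_tens_mxcoef /mxcoef rg !mxE.
  by case: eqP; rewrite ?mulr1n ?mulr0n ?scale0r.
elim: k => [|k IH]; first by rewrite !expr0 !mulr1 scale1r.
rewrite !exprSr mulrA sliceM sg mulmx_scalarE IH.
by rewrite -scalerAl -scalerAr scalerA mulrA.
Qed.

(** The functionals [h] and [mxcoef a b] act on different tensor factors, so either may come first.
    Applying [h] first gives [h x *: 1] by invariance, and [rho 1] is the identity matrix. *)
Lemma haar_slice (h : {scalar A}) :
  (forall x, h_tens_id h (Delta x) = h x *: 1) ->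
  forall x a b, h (slice x a b) = h x * (a == b)%:R.
Proof.
move=> hP x a b; rewrite mxE.
have swap z : h (id_tens_h (mxcoef a b) z) = mxcoef a b (h_tens_id h z).
  elim/tens_ind: z => [y y'||k u v IHu IHv].
  - by rewrite id_tens_mxcoef h_tens_idE !linearZ /= mulrC.
  - by rewrite !linear0.
  - by rewrite linearP linearP [X in mxcoef _ _ X]linearP mxcoef_linear -IHu -IHv.
rewrite swap hP linearZ /= /mxcoef rmorph1 !mxE.
by case: eqP; rewrite ?mulr1.
Qed.

Lemma haar_slice_grouplike (h : {scalar A}) c g y k a b :
  (forall x, h_tens_id h (Delta x) = h x *: 1) ->
  Delta g = tensor g g -> rho g = c%:M ->
  c ^+ k * h (slice y a b * g ^+ k) = h (y * g ^+ k) * (a == b)%:R.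
Proof.
move=> hP gE rg; rewrite -haar_slice // (slice_grouplike y k a b gE rg).
by rewrite linearZ.
Qed.

End Coefficient.
End Slice.

(** * Ordered products and upper triangular matrices *)

Section OrdinalProducts.
Variables (R : pzRingType) (n : nat).
Implicit Types F : 'I_n -> R.

Lemma ord_nat_ext F : exists G : nat -> R, forall i : 'I_n, F i = G i.
Proof.
exists (fun k => if insub k is Some i then F i else 1) => i.
by rewrite insubT // => ?; congr F; apply: val_inj.
Qed.

Lemma prod_ltS F (j : 'I_n) :
  \prod_(i < n | (i < j.+1)%N) F i = (\prod_(i < n | (i < j)%N) F i) * F j.
Proof.
have [G FG] := ord_nat_ext F.
have {FG} -> : F = (fun i : 'I_n => G i) by apply/funext.
by rewrite -!(big_ord_widen _ G) ?big_ord_recr // ltnW.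
Qed.

Lemma prod_split F (j : 'I_n) :
  \prod_(i < n) F i =
  (\prod_(i < n | (i < j)%N) F i) * F j * \prod_(i < n | (j < i)%N) F i.
Proof.
have [G FG] := ord_nat_ext F.
have {FG} -> : F = (fun i : 'I_n => G i) by apply/funext.
have jn := ltnW (ltn_ord j).
rewrite -(big_ord_widen _ G) // -!(big_mkord xpredT G) -mulrA.
rewrite (@big_cat_nat _ _ _ j) //=; congr (_ * _).
by rewrite big_ltn //; congr (_ * _); rewrite big_geq_mkord.
Qed.

Lemma prod_subst F (j : 'I_n) y :
  (\prod_(i < n | (i < j)%N) F i) * y * (\prod_(i < n | (j < i)%N) F i) =
  \prod_(i < n) (if i == j then y else F i).
Proof.
rewrite (prod_split _ j) eqxx.
congr (_ * _ * _); apply: eq_bigr => i ij; case: eqP ij => // ->;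
  by rewrite ltnn.
Qed.

End OrdinalProducts.

Section UpperTriangular.
Variable R : nzRingType.

Definition tri2 (a b c : R) : 'M[R]_2 :=
  \matrix_(i, j) if i == 0 then (if j == 0 then a else b)
                 else (if j == 0 then 0 else c).

Lemma tri2P (M : 'M[R]_2) a b c :
  M 0 0 = a -> M 0 1 = b -> M 1 0 = 0 -> M 1 1 = c -> M = tri2 a b c.
Proof.
have ord2 (i : 'I_2) : {i = 0} + {i = 1}.
  by case: i => [[|[|//]] i2]; [left|right]; apply: val_inj.
move=> h00 h01 h10 h11; apply/matrixP => i j; rewrite mxE.
by case: (ord2 i) (ord2 j) => -> [] ->.
Qed.

Lemma tri2M a b c a' b' c' :
  tri2 a b c * tri2 a' b' c' = tri2 (a * a') (a * b' + b * c') (c * c').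
Proof.
by apply: tri2P; rewrite !mxE !big_ord_recl big_ord0 !mxE /=;
  rewrite ?(mul0r, mulr0, add0r, addr0).
Qed.

Lemma tri2_1 : tri2 1 0 1 = 1.
Proof. by apply/esym/tri2P; rewrite mxE. Qed.

Lemma tri2Z k a b c : k *: tri2 a b c = tri2 (k * a) (k * b) (k * c).
Proof. by apply: tri2P; rewrite !mxE ?mulr0. Qed.

Lemma scalar_tri2 a : a%:M = tri2 a 0 a.
Proof. by apply: tri2P; rewrite mxE. Qed.

Lemma tri2_diagX a c k : tri2 a 0 c ^+ k = tri2 (a ^+ k) 0 (c ^+ k).
Proof.
elim: k => [|k IH]; first by rewrite tri2_1.
by rewrite !exprS IH tri2M mulr0 mul0r addr0.
Qed.

(** A path from 0 to 1 through triangular factors jumps at exactly one factor [k], with entries [a]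
    before it and [c] after it. *)
Lemma prod_tri2 n (a b c : 'I_n -> R) :
  \prod_(i < n) tri2 (a i) (b i) (c i) =
  tri2 (\prod_(i < n) a i)
    (\sum_(k < n) (\prod_(i < n | (i < k)%N) a i) * b k *
                  \prod_(i < n | (k < i)%N) c i)
    (\prod_(i < n) c i).
Proof.
elim: n a b c => [|n IH] a b c; first by rewrite !big_ord0 tri2_1.
rewrite !big_ord_recr /= IH tri2M; congr tri2.
rewrite [LHS]addrC; congr (_ + _).
  rewrite mulr_suml; apply: eq_bigr => k _.
  rewrite -!mulrA; congr (_ * (_ * _)).
  - rewrite [RHS]big_mkcond big_ord_recr /= ltnNge ltnW //= mulr1.
    by rewrite -big_mkcond.
  - rewrite [RHS]big_mkcond big_ord_recr /= ltn_ord; congr (_ * _).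
    by rewrite -big_mkcond.
rewrite [X in _ = _ * X]big_pred0; last first.
  by move=> i; apply/negbTE; rewrite -leqNgt -ltnS.
rewrite mulr1; congr (_ * _); rewrite [RHS]big_mkcond big_ord_recr /= ltnn mulr1.
by rewrite -big_mkcond; apply: eq_bigl => i; rewrite ltn_ord.
Qed.

End UpperTriangular.

(** * Upper triangular representations of O(GL_q(n)) *)

Section QuantumGroup.
Variables (K : fieldType) (q : K) (n : nat).
Local Notation A := (OGL n q).
Local Notation x := (@OGL_x K n q).
Local Notation dinv := (OGL_detinv n q).

Lemma OGL_relE (u v : freealg K (OGL_gens n)) :
  OGL_rels q u v ->
  @ppi K (OGL_presentation n q) u = @ppi K (OGL_presentation n q) v.
Proof. by move=> uv; apply/ppiP/Pideal_rel. Qed.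

Lemma OGL_colE (i l j : 'I_n) : (i < l)%N ->
  x i j * x l j = q *: (x l j * x i j).
Proof.
move=> il; have := OGL_relE (OGL_col q j il).
by rewrite linearZ !rmorphM.
Qed.
Lemma OGL_rowE (i j k : 'I_n) : (j < k)%N ->
  x i j * x i k = q *: (x i k * x i j).
Proof.
move=> il; have := OGL_relE (OGL_row q i il).
by rewrite linearZ !rmorphM.
Qed.
Lemma OGL_antiE (i l j k : 'I_n) : (i < l)%N -> (j < k)%N ->
  x i k * x l j = x l j * x i k.
Proof.
move=> il jk; have := OGL_relE (OGL_anti q il jk).
by rewrite !rmorphM.
Qed.
Lemma OGL_diagE (i l j k : 'I_n) : (i < l)%N -> (j < k)%N ->
  x i j * x l k = x l k * x i j + (q - q^-1) *: (x i k * x l j).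
Proof.
move=> il jk; have := OGL_relE (OGL_diag q il jk).
by rewrite rmorphD /= linearZ /= !rmorphM.
Qed.
Lemma OGL_dinvE : qdet q x * dinv = 1.
Proof.
have := OGL_relE (OGL_dinvr n q).
rewrite rmorphM rmorph1 /= => <-; congr (_ * _).
rewrite /qdet raddf_sum; apply: eq_bigr => s _.
by rewrite /= linearZ /= rmorph_prod.
Qed.

Definition tri_gen (B : algType K) (dg : 'I_n -> B) (j j' : 'I_n) (E : B)
    (a b : 'I_n) : B :=
  if a == b then dg a else if (a == j) && (b == j') then E else 0.

(** As [j] and [j'] are adjacent, the one entry off the diagonal lies just above it. Every relation
    then reduces to 0 = 0 or to a commutation hypothesis, and the correction term with q - q^-1
    always vanishes. *)
Lemma tri_rep (B : algType K) (dg : 'I_n -> B) (j j' : 'I_n) (E di : B) :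
  j' = j.+1 :> nat ->
  (forall a b, dg a * dg b = dg b * dg a) ->
  dg j * E = q *: (E * dg j) -> E * dg j' = q *: (dg j' * E) ->
  (forall a, a != j -> a != j' -> dg a * E = E * dg a) ->
  (forall a, dg a * di = di * dg a) -> E * di = di * E ->
  di * \prod_(a < n) dg a = 1 -> \prod_(a < n) dg a * di = 1 ->
  exists rho : {lrmorphism A -> B},
    (forall a b, rho (x a b) = tri_gen dg j j' E a b) /\ rho dinv = di.
Proof.
move=> jj' dgC jE Ej' dgE dgdi Edi didet detdi.
pose e (g : OGL_gens n) : B :=
  if g is Some (a, b) then tri_gen dg j j' E a b else di.
have low (a b : 'I_n) : (b < a)%N -> tri_gen dg j j' E a b = 0.
  move=> ba; rewrite /tri_gen; case: eqP => [ab|_].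
    by rewrite ab ltnn in ba.
  by case: eqP => // aj; case: eqP => // bj; rewrite aj bj jj' in ba; lia.
have eqdet : evalB e (qdet q (fun a b => gen K (Some (a, b) : OGL_gens n))) =
    \prod_(a < n) dg a.
  rewrite raddf_sum (bigD1 1%g) //= [X in _ + X]big1 => [|s s1].
    rewrite addr0 linearZ /= (_ : invs _ = 0%N); last first.
      apply/eqP; rewrite cards_eq0; apply/eqP/setP => p.
      by rewrite !inE !perm1; lia.
    rewrite expr0 scale1r rmorph_prod; apply: eq_bigr => a _.
    by rewrite /= evalB_gen /= perm1 /tri_gen eqxx.
  rewrite linearZ /= rmorph_prod /=.
  (* A permutation other than 1 selects an entry below the diagonal: if s a >= a for all a, equality
     of the two sums forces s = 1. *)
  have [a sa] : exists a, (s a < a)%N.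
    apply/existsP; apply: contraNT s1; rewrite negb_exists => /forallP le.
    have sumE : (\sum_(a < n) (s a : nat) = \sum_(a < n) (a : nat))%N.
      by rewrite [RHS](reindex_inj (@perm_inj _ s)).
    apply/eqP/perm.permP => a; rewrite perm1; apply: val_inj => /=.
    have le' (b : 'I_n) : (b <= s b)%N by rewrite leqNgt; apply: le.
    apply/eqP; rewrite eqn_leq le' andbT leqNgt; apply/negP => lt.
    suff : (\sum_(a < n) (a : nat) < \sum_(a < n) (s a : nat))%N.
      by rewrite sumE ltnn.
    rewrite (bigD1 a) // [ltnRHS](bigD1 a) //= -addSn leq_add //.
    by apply: leq_sum.
  rewrite (prod_split _ a) evalB_gen /= low //.
  by rewrite mulr0 mul0r scaler0.
have eP u v : OGL_rels q u v -> evalB e u = evalB e v.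
  case=> [i l k il|i k k' kk'|i l k k' il kk'|i l k k' il kk'|a b||].
  - rewrite linearZ /= !rmorphM /= !evalB_gen /= /tri_gen.
    have [ik|ik] := eqVneq i k.
      have -> : (l == k) = false by apply/eqP=> lk; move: il; rewrite ik lk ltnn.
      case: (altP (l =P j)) => [lj|lj] /=; last by rewrite mulr0 mul0r scaler0.
      case: (altP (k =P j')) => [kj|kj] /=; last by rewrite mulr0 mul0r scaler0.
      by move: il; rewrite ik lj kj jj'; lia.
    case: (altP (i =P j)) => [ij|ij] /=; last by rewrite mulr0 mul0r scaler0.
    case: (altP (k =P j')) => [kj|kj] /=; last by rewrite mulr0 mul0r scaler0.
    case: (altP (l =P k)) => [lk|lk]; first by rewrite lk kj.
    case: (altP (l =P j)) => [lj|lj]; last by rewrite mulr0 mul0r scaler0.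
    by move: il; rewrite ij lj ltnn.
  - rewrite linearZ /= !rmorphM /= !evalB_gen /= /tri_gen.
    have [ik|ik] := eqVneq i k'.
      have -> : (i == k) = false.
        by apply/eqP=> lk; move: kk'; rewrite -ik lk ltnn.
      case: (altP (i =P j)) => [ij|ij] /=; last by rewrite mulr0 mul0r scaler0.
      case: (altP (k =P j')) => [kj|kj] /=; last by rewrite mulr0 mul0r scaler0.
      by move: kk'; rewrite -ik ij kj jj'; lia.
    case: (altP (i =P j)) => [ij|ij] /=; last by rewrite mulr0 mul0r scaler0.
    case: (altP (k' =P j')) => [kj|kj] /=; last by rewrite mulr0 mul0r scaler0.
    case: (altP (i =P k)) => [lk|lk]; first by rewrite ij.
    case: (altP (k =P j')) => [lj|lj]; last by rewrite mulr0 mul0r scaler0.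
    by move: kk'; rewrite kj lj ltnn.
  - rewrite !rmorphM /= !evalB_gen /=.
    have [ki|ik] := ltnP k' i; first by rewrite (low i k') // mul0r mulr0.
    have [kl|lk] := ltnP k l; first by rewrite (low l k) // mul0r mulr0.
    rewrite /tri_gen.
    have -> : (i == k') = false by apply/eqP => e1; rewrite e1 in il; lia.
    case: (altP (i =P j)) => [ij|ij] /=; last by rewrite mulr0 mul0r.
    case: (altP (k' =P j')) => [kj|kj] /=; last by rewrite mulr0 mul0r.
    by rewrite ij in il; rewrite kj in kk'; lia.
  - rewrite raddfD /= linearZ /= !rmorphM /= !evalB_gen /=.
    have -> : tri_gen dg j j' E i k' * tri_gen dg j j' E l k = 0.
      have [kl|lk] := ltnP k l; first by rewrite (low l k) // mulr0.
      rewrite /tri_gen.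
      have -> : (i == k') = false by apply/eqP => e1; rewrite e1 in il; lia.
      case: (altP (i =P j)) => [ij|ij] /=; last by rewrite mul0r.
      case: (altP (k' =P j')) => [kj|kj] /=; last by rewrite mul0r.
      by rewrite ij in il; rewrite kj in kk'; lia.
    rewrite scaler0 addr0 /tri_gen.
    have [ik|ik] := eqVneq i k.
      have [lk|lk] := eqVneq l k'; first exact: dgC.
      case: (altP (l =P j)) => [lj|lj] /=; last by rewrite mulr0 mul0r.
      case: (altP (k' =P j')) => [kj|kj] /=; last by rewrite mulr0 mul0r.
      rewrite dgE //; apply/eqP => e1; first by rewrite e1 lj ltnn in il.
      by rewrite e1 lj jj' in il; lia.
    case: (altP (i =P j)) => [ij|ij] /=; last by rewrite mulr0 mul0r.
    case: (altP (k =P j')) => [kj|kj] /=; last by rewrite mulr0 mul0r.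
    have [lk|lk] := eqVneq l k'.
      rewrite dgE //; apply/eqP => e1; first by rewrite e1 ij ltnn in il.
      by rewrite -lk e1 kj ltnn in kk'.
    case: (altP (l =P j)) => [lj|lj] /=; last by rewrite mulr0 mul0r.
    by rewrite lj ij ltnn in il.
  - rewrite !rmorphM /= !evalB_gen /= /tri_gen.
    by case: ifP => [_ //|_]; case: ifP => // _; rewrite mulr0 mul0r.
  - by rewrite rmorphM /= eqdet evalB_gen rmorph1.
  - by rewrite rmorphM /= eqdet evalB_gen rmorph1.
have [rho rhoE] := prep_exists (P := OGL_presentation n q) eP.
exists rho; split=> [a b|]; exact: rhoE.
Qed.

End QuantumGroup.

(** * Linear relations between values on ordered monomials *)

Section OrderedMonomials.
Variables (K : fieldType) (A : algType K) (q : K) (n : nat).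
Variable x : 'I_n -> 'I_n -> A.

Definition mon (N : 'M[nat]_n) : A :=
  \prod_(i < n) \prod_(j < n) x i j ^+ N i j.

(* If [N i j' = 0] the truncated predecessor makes this meaningless; the
   relations below then multiply it by [qnat 0 = 0]. *)
Definition shift_unit (N : 'M[nat]_n) (i j j' : 'I_n) : 'M[nat]_n :=
  \matrix_(a, b) if a == i then (if b == j then (N i j).+1
                                 else if b == j' then (N i j').-1 else N i b)
                 else N a b.

(** The q-integer (1 - q^(2k)) / (1 - q^2), written without division. *)
Definition qnat (k : nat) : K := \sum_(i < k) q ^+ (2 * i).

Lemma qnat0 : qnat 0 = 0. Proof. by rewrite /qnat big_ord0. Qed.
Lemma qnatS k : qnat k.+1 = 1 + q ^+ 2 * qnat k.
Proof.
rewrite /qnat big_ord_recl muln0 expr0; congr (_ + _).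
rewrite mulr_sumr; apply: eq_bigr => i _.
by rewrite lift0 mulnS exprD.
Qed.

(** Exponent of q gathered when the off-diagonal entry is taken in row [i]: rows above act by
    [lowering_l], rows below by [lowering_r], and in row [i] the powers of column [j] come first. *)
Definition lowering_weight (N : 'M[nat]_n) (i j j' : 'I_n) : nat :=
  (\sum_(a < n | (a < i)%N) (N a j + N a j') + N i j +
   2 * \sum_(a < n | (i < a)%N) N a j')%N.

Lemma prod_if1 (R : pzRingType) (j : 'I_n) (c : R) (F : 'I_n -> nat) :
  \prod_(i < n) (if i == j then c else 1) ^+ F i = c ^+ F j.
Proof.
rewrite (prod_split _ j) eqxx !big1 ?mul1r ?mulr1 // => i ij;
  by case: eqP ij => [->|]; rewrite ?ltnn ?expr1n.
Qed.

Lemma prod_scale (c : 'I_n -> K) (F : 'I_n -> A) (P : pred 'I_n) :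
  \prod_(i < n | P i) (c i *: F i) =
  (\prod_(i < n | P i) c i) *: \prod_(i < n | P i) F i.
Proof. exact: scaler_prod. Qed.

Variables (d : nat) (S : A -> 'M[A]_d.+1).
Hypothesis S1 : S 1 = 1.
Hypothesis SM : {morph S : a b / a * b}.

Lemma morphX a k : S (a ^+ k) = S a ^+ k.
Proof. by elim: k => [|k IH]; rewrite ?S1 // !exprS SM IH. Qed.

Lemma morph_prod (F : 'I_n -> A) :
  S (\prod_(i < n) F i) = \prod_(i < n) S (F i).
Proof. exact: (big_morph _ SM S1). Qed.

End OrderedMonomials.

Section LoweringOperator.
Variables (K : fieldType) (A : algType K) (q : K) (n : nat).
Variable x : 'I_n -> 'I_n -> A.
Variables (j j' : 'I_n).
Hypothesis jj' : j' = j.+1 :> nat.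
Hypothesis x_row : forall i, x i j * x i j' = q *: (x i j' * x i j).

(** With [lowering_r], the diagonal of the image of x_{kk}. The values q-commute with [tri2 0 1 0]
    as [tri_rep] requires, and both products over k are q^2, so that the determinant acts by a
    scalar. *)
Definition lowering_l (k : 'I_n) : K :=
  if k == j then q else if k == j' then q else 1.
Definition lowering_r (k : 'I_n) : K := if k == j' then q ^+ 2 else 1.
Local Notation alpha := lowering_l.
Local Notation beta := lowering_r.
Definition lowering_mx (a b : 'I_n) : 'M[K]_2 :=
  tri_gen (fun k => tri2 (alpha k) 0 (beta k)) j j' (tri2 0 1 0) a b.

Lemma neq_jj' : (j == j') = false.
Proof. by apply/eqP => e; have := jj'; rewrite -e; lia. Qed.

Variable S : A -> 'M[A]_2.
Hypothesis S1 : S 1 = 1.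
Hypothesis SM : {morph S : a b / a * b}.
Variable R : 'I_n -> 'I_n -> 'M[K]_2.
Hypothesis RE : forall a b, R a b = lowering_mx a b.
Hypothesis Sx' : forall i k a b, S (x i k) a b = \sum_p R p k a b *: x i p.

(** The slice of x_{ij'} has x_{ij} off the diagonal. By [prod_tri2], the (0, 1) entry acts as a
    twisted derivation replacing one factor of column [j'] by one of column [j]. *)
Lemma lowering_mon N : S (mon x N) 0 1 =
  \sum_i (q ^+ lowering_weight N i j j' * qnat q (N i j')) *:
           mon x (shift_unit N i j j').
Proof.
have Sx i k a b : S (x i k) a b = \sum_p lowering_mx p k a b *: x i p.
  by rewrite Sx'; apply: eq_bigr => p _; rewrite RE.
have sx i k : S (x i k) =
    tri2 (alpha k *: x i k) (if k == j' then x i j else 0) (beta k *: x i k).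
  apply: tri2P; rewrite Sx (bigD1 k) //= /lowering_mx /tri_gen eqxx !mxE /=.
  - rewrite big1 ?addr0 // => p pk; rewrite /lowering_mx /tri_gen (negPf pk).
    by case: ifP => _; rewrite !mxE scale0r.
  - rewrite scale0r add0r; have [->|kj'] := eqVneq k j'.
      rewrite (bigD1 j) /= ?neq_jj' // !eqxx /= mxE.
      rewrite scale1r big1 ?addr0 // => p /andP[pk pj].
      by rewrite /lowering_mx /tri_gen (negPf pk) (negPf pj) mxE scale0r.
    rewrite big1 // => p pk.
    by rewrite /lowering_mx /tri_gen (negPf pk) ?(negPf kj') andbF mxE scale0r.
  - rewrite scale0r add0r big1 // => p pk; rewrite /lowering_mx /tri_gen (negPf pk).
    by case: ifP => _; rewrite !mxE scale0r.
  - rewrite big1 ?addr0 // => p pk; rewrite /lowering_mx /tri_gen (negPf pk).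
    by case: ifP => _; rewrite !mxE scale0r.
(* x_{ij} x_{ij'} = q x_{ij'} x_{ij} collapses the Leibniz sum to a q-number *)
have sxj' i k : S (x i j') ^+ k =
    tri2 (q ^+ k *: x i j' ^+ k) (qnat q k *: (x i j * x i j' ^+ k.-1))
         (q ^+ (2 * k) *: x i j' ^+ k).
  rewrite sx /lowering_l /lowering_r !eqxx [j' == j]eq_sym neq_jj'.
  elim: k => [|k IH].
    by rewrite !expr0 !scale1r qnat0 scale0r tri2_1.
  rewrite exprS IH tri2M; congr tri2.
  - by rewrite -scalerAl -scalerAr scalerA -!exprS.
  - rewrite /qnat big_ord_recr /= -/(qnat q k) scalerDl; congr (_ + _).
      case: k {IH} => [|k]; first by rewrite qnat0 !scale0r mulr0.
      rewrite -scalerAl -scalerAr scalerA mulrC -scalerA; congr (_ *: _).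
      rewrite mulrA scalerAl -x_row ?jj' //.
      by rewrite -mulrA -exprS.
    by rewrite -scalerAr.
  - by rewrite -scalerAl -scalerAr scalerA -exprS -exprD mulnS.
(* Only column [j'] contributes off the diagonal; the new x_{ij} directly follows the power of
   x_{ij}, since j' = j + 1. *)
have srow i : \prod_(k < n) S (x i k) ^+ N i k =
    tri2 (q ^+ (N i j + N i j') *: \prod_(k < n) x i k ^+ N i k)
      ((q ^+ N i j * qnat q (N i j')) *: \prod_(k < n) x i k ^+ shift_unit N i j j' i k)
      (q ^+ (2 * N i j') *: \prod_(k < n) x i k ^+ N i k).
  have powE k : S (x i k) ^+ N i k =
      tri2 (alpha k ^+ N i k *: x i k ^+ N i k)
        (if k == j' then qnat q (N i j') *: (x i j * x i j' ^+ (N i j').-1) else 0)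
        (beta k ^+ N i k *: x i k ^+ N i k).
    have [->|kj'] := eqVneq k j'.
      by rewrite sxj' /lowering_l /lowering_r eqxx [j' == j]eq_sym neq_jj' -exprM.
    by rewrite sx (negPf kj') tri2_diagX !exprZn.
  rewrite (eq_bigr _ (fun k _ => powE k)) prod_tri2; congr tri2.
  - rewrite prod_scale; congr (_ *: _).
    transitivity (\prod_(k < n) ((if k == j then q else 1) ^+ N i k *
                                 (if k == j' then q else 1) ^+ N i k)).
      apply: eq_bigr => k _; rewrite /lowering_l.
      case: (k =P j) => [->|_]; last by rewrite expr1n mul1r.
      by rewrite neq_jj' expr1n mulr1.
    by rewrite big_split /= !prod_if1 exprD.
  - rewrite (bigD1 j') //= eqxx [X in _ + X]big1 ?addr0; last first.
      by move=> k /negPf ->; rewrite mulr0 mul0r.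
    have -> : \prod_(k < n) x i k ^+ shift_unit N i j j' i k =
        \prod_(k < n | (k < j)%N) x i k ^+ N i k *
        x i j ^+ (N i j).+1 * x i j' ^+ (N i j').-1 *
        \prod_(k < n | (j' < k)%N) x i k ^+ N i k.
      rewrite (prod_split _ j') [in X in X * _ * _]jj' prod_ltS.
      congr (_ * _ * _ * _).
      - apply: eq_bigr => k jk; rewrite mxE eqxx.
        by rewrite -!val_eqE /= !ltn_eqF // jj' ltnW.
      - by rewrite mxE !eqxx.
      - by rewrite mxE !eqxx [j' == j]eq_sym neq_jj'.
      - apply: eq_bigr => k jk; rewrite mxE eqxx.
        by rewrite -!val_eqE /= !gtn_eqF //; lia.
    have -> : \prod_(k < n | (j' < k)%N) (beta k ^+ N i k *: x i k ^+ N i k) =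
        \prod_(k < n | (j' < k)%N) x i k ^+ N i k.
      apply: eq_bigr => k jk.
      by rewrite /lowering_r -val_eqE /= gtn_eqF // expr1n scale1r.
    have -> : \prod_(k < n | (k < j')%N) (alpha k ^+ N i k *: x i k ^+ N i k) =
        \prod_(k < n | (k < j)%N) x i k ^+ N i k * (q ^+ N i j *: x i j ^+ N i j).
      rewrite jj' prod_ltS; congr (_ * _).
        apply: eq_bigr => k jk.
        by rewrite /lowering_l -!val_eqE /= !ltn_eqF ?expr1n ?scale1r // jj' ltnW.
      by rewrite /lowering_l eqxx.
    rewrite exprSr -!(scalerAl, scalerAr) scalerA; congr (_ *: _); first exact: mulrC.
    by rewrite !mulrA.
  - by rewrite prod_scale prod_if1 exprM.
have sE i : S (\prod_(k < n) x i k ^+ N i k) =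
    \prod_(k < n) S (x i k) ^+ N i k.
  by rewrite (morph_prod S1 SM); apply: eq_bigr => k _; rewrite (morphX S1 SM).
rewrite /mon (morph_prod S1 SM) (eq_bigr _ (fun i _ => etrans (sE i) (srow i))).
rewrite prod_tri2 mxE /=; apply: eq_bigr => i _.
rewrite !prod_scale -!expr_sum -!(scalerAl, scalerAr) !scalerA.
have -> : \prod_(a < n) \prod_(k < n) x a k ^+ shift_unit N i j j' a k =
   (\prod_(a < n | (a < i)%N) \prod_(k < n) x a k ^+ N a k) *
   (\prod_(k < n) x i k ^+ shift_unit N i j j' i k) *
   (\prod_(a < n | (i < a)%N) \prod_(k < n) x a k ^+ N a k).
  rewrite prod_subst; apply: eq_bigr => a _.
  case: eqP => [->//|/eqP/negPf ai]; apply: eq_bigr => k _.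
  by rewrite mxE ai.
congr (_ *: _); rewrite /lowering_weight -big_distrr /=.
move: (\sum_(a < n | (a < i)%N) _)%N (\sum_(a < n | (i < a)%N) _)%N => u v.
rewrite 2!exprD; ring.
Qed.

End LoweringOperator.

Section WeightOperator.
Variables (K : fieldType) (A : algType K) (q : K) (n : nat).
Variable x : 'I_n -> 'I_n -> A.
Variable k : 'I_n.
Variable S : A -> 'M[A]_1.
Hypothesis S1 : S 1 = 1.
Hypothesis SM : {morph S : a b / a * b}.

(** A character, written with 1 x 1 matrices so that [slice] applies. *)
Definition weight_mx (a b : 'I_n) : 'M[K]_1 :=
  if a == b then (if b == k then q else 1)%:M else 0.

Variable R : 'I_n -> 'I_n -> 'M[K]_1.
Hypothesis RE : forall a b, R a b = weight_mx a b.
Hypothesis Sx' : forall i k a b, S (x i k) a b = \sum_p R p k a b *: x i p.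

Lemma weight_mon N : S (mon x N) 0 0 = q ^+ (\sum_i N i k) *: mon x N.
Proof.
have Sx i b a c : S (x i b) a c = \sum_p weight_mx p b a c *: x i p.
  by rewrite Sx'; apply: eq_bigr => p _; rewrite RE.
have sx i b : S (x i b) = ((if b == k then q else 1) *: x i b)%:M.
  apply/matrixP => a c; rewrite !ord1 mxE mulr1n Sx (bigD1 b) //= /weight_mx.
  rewrite eqxx mxE mulr1n big1 ?addr0 // => p /negPf ->.
  by rewrite mxE scale0r.
have M a b : a%:M * b%:M = (a * b)%:M :> 'M[A]_1 by rewrite [RHS]scalar_mxM.
have sX i b e : S (x i b) ^+ e = (((if b == k then q else 1) *: x i b) ^+ e)%:M.
  by elim: e => [|e IH] //; rewrite !exprS IH sx M.
have P F : \prod_(a < n) (F a)%:M = (\prod_(a < n) F a)%:M :> 'M[A]_1.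
  by rewrite (big_morph (fun a : A => a%:M : 'M_1) (fun a b => esym (M a b)) erefl).
have row i : S (\prod_(b < n) x i b ^+ N i b) =
    (q ^+ N i k *: \prod_(b < n) x i b ^+ N i b)%:M.
  rewrite (morph_prod S1 SM) -(prod_if1 k q) -prod_scale -P.
  by apply: eq_bigr => b _; rewrite (morphX S1 SM) sX exprZn.
rewrite /mon (morph_prod S1 SM) (eq_bigr _ (fun i _ => row i)).
by rewrite P mxE mulr1n prod_scale expr_sum.
Qed.

End WeightOperator.

(** * Relations for the Haar state from invariance *)

Section Invariance.
Variables (K : fieldType) (q : K) (n : nat).
Hypothesis q0 : q != 0.
Hypothesis n1 : (1 < n)%N.
Hypothesis q_nroot : forall k, (0 < k)%N -> q ^+ k != 1.
Local Notation A := (OGL n q).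
Local Notation x := (@OGL_x K n q).
Local Notation dinv := (OGL_detinv n q).

Section Column.
Variables (j j' : 'I_n).
Hypothesis jj' : j' = j.+1 :> nat.

Lemma lowering_rep : exists rho : {lrmorphism A -> 'M[K]_2},
  (forall a b, rho (x a b) = lowering_mx q j j' a b) /\
  rho dinv = (q ^- 2)%:M.
Proof.
have njj' := neq_jj' jj'.
have prodE : \prod_(a < n) tri2 (lowering_l q j j' a) 0 (lowering_r q j' a) =
    (q ^+ 2)%:M.
  rewrite prod_tri2 scalar_tri2; congr tri2; last 1 first.
  - rewrite -[RHS]expr1 -(prod_if1 j' (q ^+ 2) (fun=> 1%N)).
    by apply: eq_bigr => i _; rewrite expr1.
  - transitivity (\prod_(k < n) ((if k == j then q else 1) ^+ 1 *
                                 (if k == j' then q else 1) ^+ 1)).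
      apply: eq_bigr => k _; rewrite /lowering_l.
      case: eqP => [->|_]; last by rewrite mul1r.
      by rewrite njj' mulr1.
    by rewrite big_split /= !prod_if1.
  - by rewrite big1 // => i _; rewrite mulr0 mul0r.
have qq (u v : K) : u * v = 1 -> u%:M * v%:M = 1 :> 'M[K]_2.
  by move=> uv; rewrite [LHS](esym (scalar_mxM 2 u v)) uv.
have scalC (u : K) (v : 'M[K]_2) : v * u%:M = u%:M * v.
  exact: (scalar_mxC u v).
apply: tri_rep => //.
- move=> a b; rewrite !tri2M ?(mulr0, mul0r, addr0, add0r).
  by congr tri2; exact: mulrC.
- rewrite !tri2M tri2Z ?(mulr0, mul0r, addr0, add0r).
  by rewrite /lowering_l /lowering_r eqxx njj' !mulr1.
- rewrite !tri2M tri2Z ?(mulr0, mul0r, addr0, add0r).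
  by rewrite /lowering_l /lowering_r eqxx [j' == j]eq_sym njj' mul1r mulr1.
- move=> a aj aj'; rewrite !tri2M ?(mulr0, mul0r, addr0, add0r).
  by rewrite /lowering_l /lowering_r (negPf aj) (negPf aj').
- by rewrite prodE qq // mulVf ?expf_neq0.
- by rewrite prodE qq // mulfV ?expf_neq0.
Qed.

(** An off-diagonal entry of a slice has Haar value 0, and the twist by the inverse determinant only
    rescales by a nonzero power of q. *)
Lemma haar_lowering (h : {scalar A}) m (N : 'M[nat]_n) :
  is_haar h ->
  \sum_i q ^+ lowering_weight N i j j' * qnat q (N i j') *
         h (mon x (shift_unit N i j j') * dinv ^+ m) = 0.
Proof.
move=> [_ [Delta DeltaP hD]].
have [rho [rhox rhod]] := lowering_rep.
have jltj' : (j < j')%N by rewrite jj'.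
have smon := @lowering_mon _ _ q n x j j' jj' (fun i => OGL_rowE q i jltj')
  (slice rho Delta) (slice1 _ _) (sliceM _ _) (fun a b => rho (x a b)) rhox
  (fun i k a b => slice_comul rho a b (proj1 DeltaP i k)) N.
have := haar_slice_grouplike (mon x N) m 0 1 (fun y => proj2 (hD y))
  (proj2 DeltaP) rhod.
rewrite smon mulr0 => /eqP.
rewrite mulf_eq0 expf_eq0 invr_eq0 expf_eq0 (negPf q0) !andbF /= => /eqP.
rewrite mulr_suml raddf_sum /= => {2}<-.
by apply: eq_bigr => i _; rewrite -scalerAl linearZ.
Qed.

End Column.

Lemma expr_inj a b : q ^+ a = q ^+ b -> a = b.
Proof.
wlog ab : a b / (a <= b)%N.
  by move=> H; case/orP: (leq_total a b) => /H // E /esym /E.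
rewrite -(subnK ab) exprD -{1}[q ^+ a]mul1r => /mulIf e.
case E: (b - a)%N => [//|k].
have := q_nroot (ltn0Sn k); rewrite -E -e ?expf_neq0 //.
by rewrite eqxx.
Qed.

Lemma weight_rep (k : 'I_n) : exists rho : {lrmorphism A -> 'M[K]_1},
  (forall a b, rho (x a b) = weight_mx q k a b) /\ rho dinv = q^-1%:M.
Proof.
(* With off-diagonal value 0 any adjacent pair of columns will do. *)
pose j := Ordinal (ltnW n1); pose j' := Ordinal n1.
pose dg (a : 'I_n) : 'M[K]_1 := (if a == k then q else 1)%:M.
have M (u v : K) : u%:M * v%:M = (u * v)%:M :> 'M[K]_1.
  by rewrite [RHS]scalar_mxM.
have prodE : \prod_(a < n) dg a = q%:M.
  rewrite -[in RHS](expr1 q) -(prod_if1 k q (fun=> 1%N)).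
  rewrite [RHS](big_morph (fun a : K => a%:M : 'M_1) (fun a b => esym (M a b)) erefl).
  by [].
have [|||||||||rho [rhox rhod]] := @tri_rep K q n 'M[K]_1 dg j j' 0 q^-1%:M;
  rewrite ?mulr0 ?mul0r ?scaler0 //.
- by move=> a b; rewrite !M mulrC.
- by move=> a _ _; rewrite mulr0 mul0r.
- by move=> a; rewrite !M mulrC.
- by rewrite prodE M mulVf.
- by rewrite prodE M mulfV.
exists rho; split=> // a b; rewrite rhox /tri_gen /weight_mx.
by case: eqP => [->//|_]; case: ifP.
Qed.

(** Invariance under the character at [k] multiplies the value by q to the power column sum minus m,
    which is 1 only when the sum is m. *)
Lemma haar_weight (h : {scalar A}) m (N : 'M[nat]_n) k : is_haar h ->
  (\sum_i N i k)%N != m -> h (mon x N * dinv ^+ m) = 0.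
Proof.
move=> [_ [Delta DeltaP hD]] Nk.
have [rho [rhox rhod]] := weight_rep k.
have smon := @weight_mon _ _ q n x k
  (slice rho Delta) (slice1 _ _) (sliceM _ _) (fun a b => rho (x a b)) rhox
  (fun i k a b => slice_comul rho a b (proj1 DeltaP i k)) N.
have := haar_slice_grouplike (mon x N) m 0 0 (fun y => proj2 (hD y))
  (proj2 DeltaP) rhod.
rewrite smon mulr1 -scalerAl linearZ /= mulrA exprVn => e; move: e.
apply: contra_eq => nz; apply: contraNneq Nk => e.
apply/eqP/expr_inj; apply: (mulIf (invr_neq0 (expf_neq0 m q0))).
rewrite mulfV ?expf_neq0 // mulrC; apply: (mulIf nz).
by rewrite e mul1r.
Qed.
End Invariance.

(** * Uniqueness of the solution of the column relations *)

Section Uniqueness.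
Variables (K : fieldType) (q : K) (n m : nat) (psi : 'M[nat]_n -> K).

Definition row_sums (N : 'M[nat]_n) : Prop := forall i, (\sum_j N i j)%N = m.

Definition antidiag : 'M[nat]_n :=
  \matrix_(i, j) if j == rev_ord i then m else 0%N.

(** For [f] = 1 this concerns row sums, for [f b] = n - b the induction measure of [psi_eq0]. *)
Lemma sum_move (f : 'I_n -> nat) (N : 'M[nat]_n) i (j j' : 'I_n) :
  j != j' -> (0 < N i j')%N ->
  (\sum_b f b * shift_unit N i j j' i b + f j' = \sum_b f b * N i b + f j)%N.
Proof.
move=> jj' Nj'; rewrite (bigD1 j) //= (bigD1 j') 1?eq_sym //=.
rewrite [in RHS](bigD1 j) //= [in RHS](bigD1 j') 1?eq_sym //=.
rewrite !mxE !eqxx [j' == j]eq_sym (negPf jj').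
rewrite (eq_bigr (fun b => f b * N i b)%N) => [|b /andP[bj bj']]; last first.
  by rewrite mxE eqxx (negPf bj) (negPf bj').
by case: (N i j') Nj' => // k _; rewrite /= !mulnS; lia.
Qed.

Lemma row_sums_move (N : 'M[nat]_n) i (j j' : 'I_n) :
  j != j' -> (0 < N i j')%N -> row_sums N -> row_sums (shift_unit N i j j').
Proof.
move=> jj' Nj' Nr a; have [->|ai] := eqVneq a i.
  have := sum_move (fun=> 1%N) jj' Nj'.
  by rewrite -!big_distrr /= !mul1n Nr => /addIn.
by rewrite -[RHS](Nr a); apply: eq_bigr => b _; rewrite mxE (negPf ai).
Qed.

Hypothesis q0 : q != 0.
Hypothesis qnat_neq0 : forall k, qnat q k.+1 != 0.
Hypothesis psi_lowering : forall (j j' : 'I_n) (N : 'M[nat]_n), j' = j.+1 :> nat -> row_sums N ->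
  \sum_i q ^+ lowering_weight N i j j' * qnat q (N i j') * psi (shift_unit N i j j') = 0.
Hypothesis psi_weight : forall (N : 'M[nat]_n) k, (\sum_i N i k)%N != m -> psi N = 0.

(** Outer induction on the number [k] of bottom rows still arbitrary; inner induction on a weighted
    sum of the first such row, which falls when a unit moves right. *)
Lemma psi_eq0 : psi antidiag = 0 -> forall N, row_sums N -> psi N = 0.
Proof.
move=> psi0.
suff H k : (k <= n)%N -> forall N, row_sums N ->
    (forall i j : 'I_n, (i < n - k)%N -> N i j = antidiag i j) -> psi N = 0.
  by move=> N Nr; apply: (H n) => // i j; rewrite subnn.
elim: k => [|k IHk] kn N Nr.
  rewrite subn0 => Na; rewrite (_ : N = antidiag) //.
  by apply/matrixP => i j; apply: Na.
have rk : (n - k.+1 < n)%N by lia.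
pose c := Ordinal rk.
have [d] := ubnP (\sum_(b : 'I_n) (n - b) * N c b)%N.
elim: d => // d IHd in N Nr *; rewrite ltnS => Nd Na.
have [/forallP Ncol|] := boolP [forall b, (\sum_i N i b)%N == m]; last first.
  by rewrite negb_forall => /existsP[b]; apply: psi_weight.
(* Column b > k already receives m from the antidiagonal row [rev_ord b] above [c], which exhausts
   its sum. *)
have Nc0 (b : 'I_n) : (k < b)%N -> N c b = 0%N.
  move=> kb; have := eqP (Ncol b).
  rewrite (bigD1 (rev_ord b)) //= Na /= ?mxE ?rev_ordK ?eqxx; last by have := ltn_ord b; lia.
  rewrite (bigD1 c) //=; first by lia.
  by rewrite -val_eqE /=; have := ltn_ord b; lia.
have [/forallP Nc|] := boolP [forall b : 'I_n, (b < k)%N ==> (N c b == 0)%N].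
  apply: (IHk (ltnW kn)) => // i j ik.
  have [ik'|ik'] := ltnP i (n - k.+1); first exact: Na.
  have -> : i = c by apply: val_inj => /=; lia.
  have Nj0 b : b != rev_ord c -> N c b = 0%N.
    rewrite -val_eqE /= => bc.
    have [bk|kb] := ltnP b k; first by have /implyP/(_ bk)/eqP := Nc b.
    by apply: Nc0; lia.
  rewrite mxE; case: eqP => [->|/eqP/Nj0 //].
  rewrite -(Nr c) (bigD1 (rev_ord c)) //= big1 ?addn0 // => b; exact: Nj0.
(* Some unit lies left of column k, where the antidiagonal meets row [c]. Let [N'] have it moved one
   step right: the relation for [N'] contains [psi N] as its term of row [c]. *)
rewrite negb_forall => /existsP[j]; rewrite negb_imply -lt0n => /andP[jk Ncj].
have j1n : (j.+1 < n)%N by lia.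
pose j' := Ordinal j1n.
have j'j : j' != j by rewrite -val_eqE /=; lia.
pose N' := shift_unit N c j' j.
have N'r : row_sums N' by apply: row_sums_move.
have := psi_lowering (j := j) (j' := j') erefl N'r.
have N'E : shift_unit N' c j j' = N.
  apply/matrixP => a b; rewrite !mxE !eqxx [j == j']eq_sym (negPf j'j).
  have [->|//] := eqVneq a c; have [->|bj] := eqVneq b j.
    by rewrite prednK.
  by have [->|//] := eqVneq b j'.
rewrite (bigD1 c) //= N'E big1 => [|i ic].
  rewrite addr0 => /eqP; rewrite !mulf_eq0 expf_eq0 (negPf q0) andbF /=.
  by rewrite mxE !eqxx (negPf (qnat_neq0 _)) => /eqP.
have N'i b : N' i b = N i b by rewrite mxE (negPf ic).
case E: (N' i j') => [|e]; first by rewrite qnat0 mulr0 mul0r.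
have N'ij' : (0 < N' i j')%N by rewrite E.
(* Above [c], the antidiagonal rows are 0 in column [j'], against [N'ij']. Below [c], the shift
   leaves row [c] of [N'] intact, and its measure is smaller than that of [N]. *)
have [ik|ik] := ltnP i (n - k.+1).
  move: E; rewrite N'i Na // mxE -val_eqE /=.
  by have -> : (j.+1 == n - i.+1)%N = false by lia.
rewrite IHd ?mulr0 //.
- by apply: row_sums_move => //; rewrite eq_sym.
- have rowE b : shift_unit N' i j j' c b = N' c b by rewrite mxE eq_sym (negPf ic).
  have -> : (\sum_(b < n) (n - b) * shift_unit N' i j j' c b =
             \sum_(b < n) (n - b) * N' c b)%N.
    by apply: eq_bigr => b _; rewrite rowE.
  rewrite -(ltn_add2r (n - j)) (sum_move (fun b : 'I_n => n - b)%N j'j Ncj).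
  by rewrite -addnS leq_add //=; have := ltn_ord j; lia.
- move=> a b ak; have ai : a != i by rewrite -val_eqE /=; lia.
  have ac : a != c by rewrite -val_eqE /=; lia.
  by rewrite mxE (negPf ai) mxE (negPf ac) Na.
Qed.
End Uniqueness.

(** * Straightening powers of the quantum determinant *)

Section LinearSpan.
Variables (K : fieldType) (A : algType K).
Implicit Types (G : A -> Prop) (u v : A).

Inductive lspan G : A -> Prop :=
| lspan0 : lspan G 0
| lspanZD c u v : G u -> lspan G v -> lspan G (c *: u + v).

Lemma lspan_gen G u : G u -> lspan G u.
Proof.
by move=> Gu; rewrite -[u]addr0 -[u]scale1r; apply: lspanZD => //; exact: lspan0.
Qed.

Lemma lspanD G u v : lspan G u -> lspan G v -> lspan G (u + v).
Proof.
by move=> Gu Gv; elim: Gu => [|c {}u w Gu _ IH]; rewrite ?add0r // -addrA;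
  apply: lspanZD.
Qed.

Lemma lspanZ G c u : lspan G u -> lspan G (c *: u).
Proof.
elim=> [|d {}u w Gu _ IH]; first by rewrite scaler0; exact: lspan0.
by rewrite scalerDr scalerA; apply: lspanZD.
Qed.

Lemma lspan_sum G (I : Type) (r : seq I) (F : I -> A) :
  (forall i, lspan G (F i)) -> lspan G (\sum_(i <- r) F i).
Proof.
by move=> GF; elim/big_ind: _ => //; [exact: lspan0 | exact: lspanD].
Qed.

Lemma lspan_linear G G' (f : A -> A) : linear f ->
  (forall u, G u -> lspan G' (f u)) -> forall u, lspan G u -> lspan G' (f u).
Proof.
move=> fl ff u; elim=> [|c {}u v Gu _ IH].
  have := fl (-1) 0 0; rewrite !scaleN1r !addNr => ->; exact: lspan0.
by rewrite fl; apply: lspanD => //; apply: lspanZ; apply: ff.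
Qed.

Lemma lspan_mull G G' a : (forall u, G u -> lspan G' (a * u)) ->
  forall u, lspan G u -> lspan G' (a * u).
Proof.
by apply: lspan_linear => c u v; rewrite mulrDr scalerAr.
Qed.

Lemma lspan_mulr G G' a : (forall u, G u -> lspan G' (u * a)) ->
  forall u, lspan G u -> lspan G' (u * a).
Proof.
by apply: lspan_linear => c u v; rewrite mulrDl scalerAl.
Qed.

Lemma lspan_eq0 G (f : {scalar A}) : (forall u, G u -> f u = 0) ->
  forall u, lspan G u -> f u = 0.
Proof.
move=> fG u; elim=> [|c {}u v Gu _ IH]; first by rewrite raddf0.
by rewrite linearP /= fG // IH mulr0 addr0.
Qed.

End LinearSpan.

Section Straightening.
Variables (K : fieldType) (A : algType K) (q : K) (n : nat).
Variable x : 'I_n -> 'I_n -> A.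
Hypothesis q0 : q != 0.
Hypothesis x_col : forall (i l j : 'I_n), (i < l)%N ->
  x i j * x l j = q *: (x l j * x i j).
Hypothesis x_row : forall (i j k : 'I_n), (j < k)%N ->
  x i j * x i k = q *: (x i k * x i j).
Hypothesis x_anti : forall (i l j k : 'I_n), (i < l)%N -> (j < k)%N ->
  x i k * x l j = x l j * x i k.
Hypothesis x_diag : forall (i l j k : 'I_n), (i < l)%N -> (j < k)%N ->
  x i j * x l k = x l k * x i j + (q - q^-1) *: (x i k * x l j).

Definition row_word i (s : seq 'I_n) : A := \prod_(k <- s) x i k.

(** Only the columns may change: even the correction term of the diagonal relation has one letter
    from each of the two rows. *)
Lemma swap_rows (i l j k : 'I_n) : (i < l)%N ->
  lspan (fun u => exists j' k', u = x i j' * x l k') (x l k * x i j).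
Proof.
move=> il; have [jk|kj|jk] := ltngtP j k.
- rewrite -[x l k * x i j](addrK ((q - q^-1) *: (x i k * x l j))) -x_diag //.
  apply: lspanD; first by apply: lspan_gen; exists j, k.
  by rewrite -scaleNr; apply: lspanZ; apply: lspan_gen; exists k, j.
- by rewrite -x_anti //; apply: lspan_gen; exists j, k.
have -> : j = k by apply: val_inj.
rewrite -[X in lspan _ X]scale1r -(mulVf q0) -scalerA -x_col //.
by apply: lspanZ; apply: lspan_gen; exists k, k.
Qed.

Lemma row_word_swap (i l j : 'I_n) s : (i < l)%N ->
  lspan (fun u => exists j' s', u = x i j' * row_word l s' /\ size s' = size s)
        (row_word l s * x i j).
Proof.
move=> il; elim: s => [|k s IH].
  apply: lspan_gen; exists j, [::].
  by rewrite /row_word big_nil mul1r mulr1.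
rewrite /row_word big_cons -/(row_word l s) -mulrA.
move: IH; apply: lspan_mull => _ [j' [s' [-> ss']]].
rewrite mulrA; move: (swap_rows j' k il); apply: lspan_mulr => _ [j2 [k2 ->]].
apply: lspan_gen; exists j2, (k2 :: s'); split; last by rewrite /= ss'.
by rewrite /row_word big_cons mulrA.
Qed.

Definition words (r : seq 'I_n) (s : 'I_n -> seq 'I_n) : A :=
  \prod_(i <- r) row_word i (s i).

Lemma words_cons i r s : words (i :: r) s = row_word i (s i) * words r s.
Proof. by rewrite /words big_cons. Qed.

Definition set_word (s : 'I_n -> seq 'I_n) l w : 'I_n -> seq 'I_n :=
  fun i => if i == l then w else s i.

Lemma words_set r s l w : l \notin r -> words r (set_word s l w) = words r s.
Proof.
move=> lr; rewrite /words [LHS]big_seq_cond [RHS]big_seq_cond.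
apply: eq_bigr => i; rewrite andbT /set_word => ir.
by case: eqP => // il; rewrite -il ir in lr.
Qed.

Lemma words_swap (i j : 'I_n) r s : uniq r -> all (fun l : 'I_n => i < l)%N r ->
  lspan (fun u => exists j' s', u = x i j' * words r s' /\
                  forall l, size (s' l) = size (s l))
        (words r s * x i j).
Proof.
elim: r => [_ _|l r IH /= /andP[lr ur] /andP[il ir]].
  by apply: lspan_gen; exists j, s; rewrite /words big_nil mul1r mulr1.
rewrite words_cons -mulrA.
move: (IH ur ir); apply: lspan_mull => _ [j' [s' [-> ss']]].
rewrite mulrA; move: (row_word_swap j' (s l) il).
apply: lspan_mulr => _ [j2 [w [-> sw]]].
apply: lspan_gen; exists j2, (set_word s' l w); split.
  rewrite words_cons words_set // mulrA.
  by rewrite /set_word eqxx.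
by move=> l'; rewrite /set_word; case: eqP => [->|].
Qed.

(** Columns are left free, since straightening preserves only the number of letters from each
    row. *)
Definition degree_words r (mu : 'I_n -> nat) (u : A) : Prop :=
  exists2 s, u = words r s & forall i, size (s i) = mu i.

Lemma words_mulr (i j : 'I_n) r mu u :
  sorted (fun a b : 'I_n => a < b)%N r -> i \in r -> degree_words r mu u ->
  lspan (degree_words r (fun l => mu l + (l == i))%N) (u * x i j).
Proof.
move=> + + [s -> smu].
elim: r => [//|l r IH] /= lr; rewrite inE.
have lt_tr : transitive (fun a b : 'I_n => a < b)%N by move=> a b c; exact: ltn_trans.
have : sorted (fun a b : 'I_n => a < b)%N (l :: r) := lr.
move/(sorted_uniq lt_tr (fun a : 'I_n => ltnn a)) => /= /andP[nlr ur].
case: (eqVneq i l) => [-> _|il /= ir]; rewrite words_cons -mulrA.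
  have allr : all (fun k : 'I_n => l < k)%N r by apply: (order_path_min lt_tr).
  move: (words_swap j s ur allr); apply: lspan_mull => _ [j' [s' [-> ss']]].
  apply: lspan_gen; exists (set_word s' l (rcons (s l) j')).
    rewrite words_cons words_set // /set_word eqxx.
    by rewrite /row_word -cats1 big_cat big_seq1 mulrA.
  move=> k; rewrite /set_word; case: eqP => [->|_].
    by rewrite size_rcons smu addn1.
  by rewrite addn0 ss' smu.
move: (IH (path_sorted lr) ir); apply: lspan_mull => _ [s' -> ss'].
apply: lspan_gen; exists (set_word s' l (s l)).
  by rewrite words_cons words_set // /set_word eqxx.
move=> k; rewrite /set_word; case: eqP => [->|_]; last exact: ss'.
by rewrite smu eq_sym (negPf il) addn0.
Qed.

Local Notation full := (index_enum 'I_n).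

Lemma full_sorted : sorted (fun a b : 'I_n => a < b)%N full.
Proof.
have -> : index_enum 'I_n = enum 'I_n by rewrite enumT.
have := iota_ltn_sorted 0 n; rewrite -val_enum_ord sorted_map.
by [].
Qed.

(** Each term of the determinant has one letter from every row. *)
Lemma words_mul_qdet mu u : lspan (degree_words full mu) u ->
  lspan (degree_words full (fun l => (mu l).+1)) (u * qdet q x).
Proof.
move=> mu_u; rewrite /qdet mulr_sumr; apply: lspan_sum => s.
rewrite -scalerAr; apply: lspanZ.
have H (r : seq 'I_n) : lspan (degree_words full (fun l => mu l + count_mem l r)%N)
    (u * \prod_(i <- r) x i (s i)).
  elim/last_ind: r => [|r i IH].
    rewrite big_nil mulr1; congr (lspan (degree_words _ _) _): mu_u.
    by apply/funext => l; rewrite addn0.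
  rewrite -cats1 big_cat big_seq1 mulrA /=.
  move: IH; apply: lspan_mulr => v /(words_mulr (s i) full_sorted (mem_index_enum i)).
  congr (lspan (degree_words _ _) _); apply/funext => l.
  by rewrite count_cat /= addn0 addnA eq_sym.
congr (lspan (degree_words _ _) _): (H full); apply/funext => l.
by rewrite count_uniq_mem ?index_enum_uniq // mem_index_enum addn1.
Qed.

Lemma qdet_words m : lspan (degree_words full (fun=> m)) (qdet q x ^+ m).
Proof.
elim: m => [|m IH]; last by rewrite exprSr; apply: words_mul_qdet.
apply: lspan_gen; exists (fun=> [::]) => //.
by rewrite expr0 /words big1 // => i _; rewrite /row_word big_nil.
Qed.

Lemma row_commute i j k : exists c, x i j * x i k = c *: (x i k * x i j).
Proof.
have [jk|kj|jk] := ltngtP j k.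
- by exists q; exact: x_row.
- by exists q^-1; rewrite [X in _ = _ *: X]x_row // scalerA mulVf // scale1r.
- by exists 1; rewrite scale1r; have -> : j = k by apply: val_inj.
Qed.

Lemma row_mon_mull i j (a : 'I_n -> nat) r : uniq r -> exists c,
  x i j * \prod_(k <- r) x i k ^+ a k =
  if j \in r then c *: \prod_(k <- r) x i k ^+ (a k + (k == j))
  else c *: (\prod_(k <- r) x i k ^+ a k * x i j).
Proof.
elim: r => [_|k r IH /= /andP[kr ur]].
  by exists 1; rewrite in_nil !big_nil mulr1 mul1r scale1r.
rewrite inE; have [->|jk] := eqVneq j k.
  exists 1; rewrite !big_cons /= eqxx addn1 exprS scale1r mulrA; congr (_ * _).
  rewrite [LHS]big_seq_cond [RHS]big_seq_cond; apply: eq_bigr => l.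
  rewrite andbT => lr; case: eqP => [lk|]; last by rewrite addn0.
  by rewrite -lk lr in kr.
have [c xc] := row_commute i j k.
have {}xc e : x i j * x i k ^+ e = c ^+ e *: (x i k ^+ e * x i j).
  elim: e => [|e IHe]; first by rewrite !expr0 mul1r mulr1 scale1r.
  rewrite !exprSr mulrA IHe -scalerAl -[_ * x i j * _]mulrA xc -scalerAr scalerA.
  by rewrite mulrA.
have [d IHr] := IH ur; exists (c ^+ a k * d).
rewrite !big_cons /= mulrA xc -scalerAl -[_ * x i j * _]mulrA IHr.
by case: ifP => _; rewrite -scalerAr scalerA ?[k == j]eq_sym ?(negPf jk) ?addn0 ?mulrA.
Qed.

(** Letters of one row commute up to a scalar, so sorting them costs only a scalar. *)
Lemma row_word_mon i s : exists c (a : 'I_n -> nat),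
  row_word i s = c *: \prod_(k < n) x i k ^+ a k /\ (\sum_k a k)%N = size s.
Proof.
elim: s => [|j s [c [a [IH sa]]]].
  exists 1, (fun=> 0%N); rewrite /row_word big_nil big1 ?scale1r //.
  by split=> //; rewrite big1.
have [d] := row_mon_mull i j a (index_enum_uniq 'I_n).
rewrite mem_index_enum => E; exists (c * d), (fun k => a k + (k == j))%N.
rewrite /row_word big_cons -/(row_word i s) IH -scalerAr E scalerA.
split=> //; rewrite big_split /= sa (bigD1 j) //= eqxx big1 ?addn0 ?addn1 //.
by move=> k /negPf ->.
Qed.

Lemma qdet_span m :
  lspan (fun u => exists2 N, u = mon x N & row_sums m N) (qdet q x ^+ m).
Proof.
rewrite -[X in lspan _ X]mul1r.
move: (qdet_words m); apply: lspan_mull => _ [s -> sm]; rewrite mul1r.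
have /choice[ca caP] : forall i, exists p : K * ('I_n -> nat),
    row_word i (s i) = p.1 *: \prod_(k < n) x i k ^+ p.2 k /\ (\sum_k p.2 k)%N = m.
  by move=> i; have [c [a [E sa]]] := row_word_mon i (s i); exists (c, a);
    rewrite -(sm i).
have -> : words full s = (\prod_(i < n) (ca i).1) *:
    mon x (\matrix_(i, k) (ca i).2 k).
  rewrite /words (eq_bigr _ (fun i _ => proj1 (caP i))) prod_scale; congr (_ *: _).
  by apply: eq_bigr => i _; apply: eq_bigr => k _; rewrite mxE.
apply: lspanZ; apply: lspan_gen; eexists; first by [].
by move=> i; rewrite -[RHS](proj2 (caP i)); apply: eq_bigr => k _; rewrite mxE.
Qed.

End Straightening.

(** * The solution of the relations for 3 x 3 blocks *)

Section SixTermSum.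
Variables (K : fieldType) (q : K).
Hypothesis q0 : q != 0.
Hypothesis q2_neq1 : q ^+ 2 != 1.
Hypothesis qnat_neq0 : forall k, qnat q k.+1 != 0.

(** Extends [qnat] to all integers, so that the identities below hold for arbitrary integer
    parameters. *)
Definition qint (z : int) : K := (1 - q ^ (2 * z)) / (1 - q ^+ 2).

Lemma qint_nat (k : nat) : qint k = qnat q k.
Proof.
have nz : 1 - q ^+ 2 != 0 by rewrite subr_eq0 eq_sym.
apply: (mulIf nz); rewrite divfK //.
elim: k => [|k IH]; first by rewrite mulr0 expr0z subrr qnat0 mul0r.
rewrite qnatS [RHS]mulrDl -[_ * _ * (1 - _)]mulrA -IH mul1r.
have -> : 2 * k.+1%:Z = 2 + 2 * k%:Z by lia.
by rewrite expfzDr // mulrBr mulr1 addrA subrK.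
Qed.

Lemma qintD a b : qint (a + b) = q ^ (2 * b) * qint a + qint b.
Proof.
rewrite /qint mulrDr expfzDr // mulrA -mulrDl; congr (_ / _); ring.
Qed.

Definition qfact (k : nat) : K := \prod_(i < k) qnat q i.+1.
(** The value 0 at negative arguments makes [qint_invfact] hold for every integer, including 0. *)
Definition invfact (z : int) : K := if z is Posz k then (qfact k)^-1 else 0.

Lemma qfact_neq0 k : qfact k != 0.
Proof. by apply/prodf_neq0 => i _; exact: qnat_neq0. Qed.

Lemma qfactS k : qfact k.+1 = qnat q k.+1 * qfact k.
Proof. by rewrite /qfact big_ord_recr mulrC. Qed.

Lemma qint_invfact z : qint z * invfact z = invfact (z - 1).
Proof.
case: z => [[|k]|k]; first by rewrite qint_nat qnat0 mul0r.
  have -> : k.+1%:Z - 1 = k by lia.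
  by rewrite qint_nat /= qfactS invfM mulVKf ?qnat_neq0.
rewrite mulr0; case E: (_ - 1) => [d|//]; exfalso.
by move: E; rewrite NegzE; lia.
Qed.

Lemma invfact_lt0 z : z < 0 -> invfact z = 0.
Proof. by case: z. Qed.

Definition invfact6 (n1 n2 n3 n4 n5 n6 : int) : K :=
  invfact n1 * invfact n2 * invfact n3 * invfact n4 * invfact n5 * invfact n6.

(** Exponent of q in the closed formula, summand and prefactor together. *)
Definition term_exp (m s r l t v j : int) : int :=
  (v - j) * (v - 3 * j - 1) + 2 * j * (s + t) +
  ((2 * m + 1) * (l + r) + (v - 2) * m - 2 * l ^+ 2 - 2 * r ^+ 2 - r * l
   + 4 * s * t - 3 * v * s - 3 * v * t).

(* With [v = s + r + l + t - m], the arguments of [invfact6] are the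
   multiplicities of the permutations aek, afh, bdk, bfg, cdh, ceg whose product
   is the monomial; negative multiplicities contribute 0. *)
Definition term (m s r l t v j : int) : K :=
  (-1) ^ (j + r + l + v) * q ^ term_exp m s r l t v j *
  invfact6 (v - j) (s - v + j) (t - v + j) (l - j) (r - j) j.

Lemma sgn_odd z k : (-1) ^ (z + 1 + 2 * k) = - (-1) ^ z :> K.
Proof.
have n1 : -1 != 0 :> K by rewrite oppr_eq0 oner_eq0.
rewrite expfzDr // (expfzDr z 1) // -exprz_exp expr1z mulrN1.
by rewrite (_ : (-1) ^ 2 = 1) ?exp1rz ?mulr1 // -exprnP sqrrN expr1n.
Qed.

(** Cancellation criterion: after lowering one multiplicity in each, the two pieces have the same
    inverse factorials, the same power of q and opposite signs. *)
Lemma opposite_terms k (w w' z z' e e' : int) (c c' P P' i i' : K) :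
  c * i = P -> c' * i' = P' -> P = P' -> w + e = w' + e' -> z = z' + 1 + 2 * k ->
  q ^ w * (c * ((-1) ^ z * q ^ e * i)) +
  q ^ w' * (c' * ((-1) ^ z' * q ^ e' * i')) = 0.
Proof.
move=> cP cP' PP' we ->; rewrite sgn_odd.
have -> : q ^ w * (c * (- (-1) ^ z' * q ^ e * i)) =
   - ((-1) ^ z' * (q ^ w * q ^ e) * (c * i)) by ring.
have -> : q ^ w' * (c' * ((-1) ^ z' * q ^ e' * i')) =
   (-1) ^ z' * (q ^ w' * q ^ e') * (c' * i') by ring.
by rewrite -!expfzDr // cP cP' PP' we addNr.
Qed.

Lemma lower1 n1 n2 n3 n4 n5 n6 :
  qint n1 * invfact6 n1 n2 n3 n4 n5 n6 = invfact6 (n1 - 1) n2 n3 n4 n5 n6.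
Proof. rewrite /invfact6 -qint_invfact; ring. Qed.
Lemma lower2 n1 n2 n3 n4 n5 n6 :
  qint n2 * invfact6 n1 n2 n3 n4 n5 n6 = invfact6 n1 (n2 - 1) n3 n4 n5 n6.
Proof. rewrite /invfact6 -qint_invfact; ring. Qed.
Lemma lower3 n1 n2 n3 n4 n5 n6 :
  qint n3 * invfact6 n1 n2 n3 n4 n5 n6 = invfact6 n1 n2 (n3 - 1) n4 n5 n6.
Proof. rewrite /invfact6 -qint_invfact; ring. Qed.
Lemma lower4 n1 n2 n3 n4 n5 n6 :
  qint n4 * invfact6 n1 n2 n3 n4 n5 n6 = invfact6 n1 n2 n3 (n4 - 1) n5 n6.
Proof. rewrite /invfact6 -qint_invfact; ring. Qed.
Lemma lower5 n1 n2 n3 n4 n5 n6 :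
  qint n5 * invfact6 n1 n2 n3 n4 n5 n6 = invfact6 n1 n2 n3 n4 (n5 - 1) n6.
Proof. rewrite /invfact6 -qint_invfact; ring. Qed.
Lemma lower6 n1 n2 n3 n4 n5 n6 :
  qint n6 * invfact6 n1 n2 n3 n4 n5 n6 = invfact6 n1 n2 n3 n4 n5 (n6 - 1).
Proof. rewrite /invfact6 -qint_invfact; ring. Qed.

Section FirstColumns.
Variables (m a r l t : int).
Let v := a + l + r + t - m.
Let w0 := a + 2 * (v + 1 + (m - l - t)).
Let w1 := a + (m - a - r) + (m - 1 - a - l) + 2 * (m - l - t).
Let w2 := a + (m - a - r) + (m - 1 - a - l) + (v + 1) + l.
(** The cdh piece of the middle term. Its ceg partner has index j + 1, so this pair cancels only
    after summation over j. *)
Definition first_boundary j :=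
  q ^ (w1 + 2 * (t - v + j)) * (qint (r - j) * term m a r l t v j).
Local Notation Z := first_boundary.

(** Transposing the first two columns pairs aek with bdk, afh with bfg and cdh with ceg, which are
    [P13], [P24] and [P56]. *)
Lemma first_columns j :
  q ^ w0 * (qint (a + 1) * term m (a + 1) r l t (v + 1) j) +
  q ^ w1 * (qint (m - a - l) * term m a r l t v j) +
  q ^ w2 * (qint (l + 1) * term m a r (l + 1) t (v + 1) j) = Z j - Z (j - 1).
Proof.
have P13 : q ^ (w0 + 2 * (a + 1 - (v + 1) + j)) *
    (qint (v + 1 - j) * term m (a + 1) r l t (v + 1) j) +
    q ^ w1 * (qint (t - v + j) * term m a r l t v j) = 0.
  apply: (opposite_terms (k := 0)); [exact: lower1|exact: lower3| | |].
  - by congr invfact6; ring.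
  - by rewrite /term_exp /w0 /w1 /v; ring.
  - by ring.
have P24 : q ^ w0 * (qint (a + 1 - (v + 1) + j) * term m (a + 1) r l t (v + 1) j) +
   q ^ (w2 + 2 * j) * (qint (l + 1 - j) * term m a r (l + 1) t (v + 1) j) = 0.
  rewrite addrC; apply: (opposite_terms (k := 0)); [exact: lower4|exact: lower2| | |].
  - by congr invfact6; ring.
  - by rewrite /term_exp /w0 /w2 /v; ring.
  - by ring.
have P56 : q ^ w2 * (qint j * term m a r (l + 1) t (v + 1) j) + Z (j - 1) = 0.
  rewrite /first_boundary; apply: (opposite_terms (k := 1)); [exact: lower6|exact: lower5| | |].
  - by congr invfact6; ring.
  - by rewrite /term_exp /w1 /w2 /v; ring.
  - by ring.
(* Each of the letters a, d, g occurs in two of the six permutations; its q-integer splits along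
   their multiplicities. *)
have Q0 : qint (a + 1) = q ^ (2 * (a + 1 - (v + 1) + j)) * qint (v + 1 - j) +
    qint (a + 1 - (v + 1) + j) by rewrite -qintD; congr qint; ring.
have Q1 : qint (m - a - l) = q ^ (2 * (t - v + j)) * qint (r - j) +
    qint (t - v + j) by rewrite -qintD; congr qint; rewrite /v; ring.
have Q2 : qint (l + 1) = q ^ (2 * j) * qint (l + 1 - j) + qint j.
  by rewrite -qintD; congr qint; ring.
have := congr2 +%R P13 (congr2 +%R P24 P56); rewrite !addr0 => E.
apply: subr0_eq; rewrite -[RHS]E.
rewrite Q0 Q1 Q2 {1}/first_boundary !expfzDr //; ring.
Qed.

End FirstColumns.

Section LastColumns.
Variables (m s r l t : int).
Let v := s + l + r + t + 1 - m.
Let w0 := (m - s - r - 1) + 2 * ((m - r - t - 1) + (t + 1)).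
Let w1 := (m - s - r - 1) + (r + 1) + v + 2 * (t + 1).
Let w2 := (m - s - r - 1) + (r + 1) + v + (m - r - t - 1) + (m - l - t - 1).
(** The bfg piece of the first term, whose ceg partner has index j + 1. *)
Definition last_boundary j :=
  q ^ (w0 + 2 * (t + 1 - v + j)) * (qint (l - j) * term m s r l (t + 1) v j).
Local Notation Z := last_boundary.

(** Transposing the last two columns pairs aek with afh, bdk with cdh and bfg with ceg; the
    q-integers that split belong to b, e and h. *)
Lemma last_columns j :
  q ^ w0 * (qint (m - s - r) * term m s r l (t + 1) v j) +
  q ^ w1 * (qint (v + 1) * term m s (r + 1) l (t + 1) (v + 1) j) +
  q ^ w2 * (qint (m - l - t) * term m s (r + 1) l t v j) = Z j - Z (j - 1).
Proof.
have P12 : q ^ (w1 + 2 * j) *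
    (qint (v + 1 - j) * term m s (r + 1) l (t + 1) (v + 1) j) +
    q ^ w2 * (qint (s - v + j) * term m s (r + 1) l t v j) = 0.
  apply: (opposite_terms (k := 0)); [exact: lower1|exact: lower2| | |].
  - by congr invfact6; ring.
  - by rewrite /term_exp /w1 /w2 /v; ring.
  - by ring.
have P35 : q ^ w0 * (qint (t + 1 - v + j) * term m s r l (t + 1) v j) +
   q ^ (w2 + 2 * (s - v + j)) * (qint (r + 1 - j) * term m s (r + 1) l t v j) = 0.
  rewrite addrC; apply: (opposite_terms (k := 0)); [exact: lower5|exact: lower3| | |].
  - by congr invfact6; ring.
  - by rewrite /term_exp /w0 /w2 /v; ring.
  - by ring.
have P46 : q ^ w1 * (qint j * term m s (r + 1) l (t + 1) (v + 1) j) + Z (j - 1) = 0.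
  rewrite /last_boundary; apply: (opposite_terms (k := 1)); [exact: lower6|exact: lower4| | |].
  - by congr invfact6; ring.
  - by rewrite /term_exp /w0 /w1 /v; ring.
  - by ring.
have Q0 : qint (m - s - r) = q ^ (2 * (t + 1 - v + j)) * qint (l - j) +
    qint (t + 1 - v + j) by rewrite -qintD; congr qint; rewrite /v; ring.
have Q1 : qint (v + 1) = q ^ (2 * j) * qint (v + 1 - j) + qint j.
  by rewrite -qintD; congr qint; ring.
have Q2 : qint (m - l - t) = q ^ (2 * (s - v + j)) * qint (r + 1 - j) +
    qint (s - v + j) by rewrite -qintD; congr qint; rewrite /v; ring.
have := congr2 +%R P12 (congr2 +%R P35 P46); rewrite !addr0 => E.
apply: subr0_eq; rewrite -[RHS]E.
rewrite Q0 Q1 Q2 {1}/last_boundary !expfzDr //; ring.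
Qed.

End LastColumns.

Lemma sum_telescope (Z : int -> K) M :
  Z (- 1) = 0 -> Z M%:Z = 0 -> \sum_(j < M.+1) (Z j%:Z - Z (j%:Z - 1)) = 0.
Proof.
move=> Z1 ZM; rewrite -(big_mkord xpredT (fun j : nat => Z j%:Z - Z (j%:Z - 1))).
rewrite (eq_bigr (fun j : nat => Z (j.+1%:Z - 1) - Z (j%:Z - 1))) => [|j _].
  by rewrite telescope_sumr // sub0r Z1 subr0 (_ : M.+1%:Z - 1 = M%:Z) //; lia.
by rewrite (_ : j.+1%:Z - 1 = j%:Z) //; lia.
Qed.

Let o0 : 'I_3 := @Ordinal 3 0 isT.
Let o1 : 'I_3 := @Ordinal 3 1 isT.
Let o2 : 'I_3 := @Ordinal 3 2 isT.

Lemma ord3 (P : 'I_3 -> Prop) : P o0 -> P o1 -> P o2 -> forall i, P i.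
Proof.
move=> P0 P1 P2 [[|[|[|//]]] i3].
- by rewrite (_ : Ordinal i3 = o0) //; apply: val_inj.
- by rewrite (_ : Ordinal i3 = o1) //; apply: val_inj.
- by rewrite (_ : Ordinal i3 = o2) //; apply: val_inj.
Qed.

Lemma big_ord3 (R : Type) (idx : R) (op : Monoid.law idx) (F : 'I_3 -> R) :
  \big[op/idx]_i F i = op (F o0) (op (F o1) (F o2)).
Proof.
rewrite !big_ord_recl big_ord0 Monoid.mulm1.
by congr (op (F _) (op (F _) (F _))); apply: val_inj.
Qed.

Variable m : nat.

(** A range independent of the parameters lets the three sums of a relation be merged; [term_eq0]
    removes the excess terms. *)
Definition six_sum (s r l t v : int) : K :=
  \sum_(j < m.+1) term m%:Z s r l t v j%:Z.

Definition det_coef (N : 'M[nat]_3) : K :=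
  if [forall k, \sum_i N i k == m]%N then
    (\prod_i \prod_k qfact (N i k)) *
    six_sum (N o0 o0) (N o0 o2) (N o2 o0) (N o2 o2) (N o1 o1)
  else 0.

Lemma det_coef_weight (N : 'M[nat]_3) k : (\sum_i N i k)%N != m -> det_coef N = 0.
Proof.
rewrite /det_coef => Nk; case: ifP => // /forallP /(_ k).
by rewrite (negPf Nk).
Qed.

Lemma invfact6_eq0 n1 n2 n3 n4 n5 n6 :
  [|| n1 < 0, n2 < 0, n3 < 0, n4 < 0, n5 < 0 | n6 < 0] ->
  invfact6 n1 n2 n3 n4 n5 n6 = 0.
Proof.
rewrite /invfact6; case/or4P => [||| /or3P []] /invfact_lt0 -> ;
  by rewrite ?(mulr0, mul0r).
Qed.

Lemma term_eq0 (s r l t v j : int) :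
  [|| v - j < 0, s - v + j < 0, t - v + j < 0, l - j < 0, r - j < 0 | j < 0] ->
  term m s r l t v j = 0.
Proof. by move=> /invfact6_eq0 E; rewrite /term E mulr0. Qed.

(** Exchanges the q-integer of column [k'] for that of column [k], which the six multiplicities can
    split. *)
Lemma prod_qfact_move (N : 'M[nat]_3) i (k k' : 'I_3) : k != k' -> (0 < N i k')%N ->
  qnat q (N i k') * (\prod_a \prod_b qfact (shift_unit N i k k' a b)) =
  qnat q (N i k).+1 * \prod_a \prod_b qfact (N a b).
Proof.
move=> kk' Nk'; rewrite (bigD1 i) //= [in RHS](bigD1 i) //= !mulrA.
congr (_ * _); last first.
  apply: eq_bigr => a ai; apply: eq_bigr => b _.
  by rewrite mxE (negPf ai).
rewrite (bigD1 k) //= (bigD1 k') 1?eq_sym //=.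
rewrite [in RHS](bigD1 k) //= [in RHS](bigD1 k') 1?eq_sym //=.
rewrite !mxE !eqxx [k' == k]eq_sym (negPf kk').
rewrite (eq_bigr (fun b => qfact (N i b))) => [|b /andP[bk bk']]; last first.
  by rewrite mxE eqxx (negPf bk) (negPf bk').
case: (N i k') Nk' => // e _; rewrite /= !qfactS; ring.
Qed.

(** The truncated predecessor in [shift_unit] matches the integer parameters only at a positive
    entry. At entry 0 the left side is 0, and a negative multiplicity kills each term on the
    right. *)
Lemma lowering_det_coef_term (N : 'M[nat]_3) i (k k' : 'I_3) (s r l t v w : int) :
  k != k' ->
  ((0 < N i k')%N -> forall b, (\sum_a shift_unit N i k k' a b)%N = m) ->
  ((0 < N i k')%N ->
     [/\ shift_unit N i k k' o0 o0 = s :> int, shift_unit N i k k' o0 o2 = r :> int,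
         shift_unit N i k k' o2 o0 = l :> int, shift_unit N i k k' o2 o2 = t :> int &
         shift_unit N i k k' o1 o1 = v :> int]) ->
  (N i k' = 0%N -> forall j : nat,
     [|| v - j%:Z < 0, s - v + j%:Z < 0, t - v + j%:Z < 0, l - j%:Z < 0 |
         r - j%:Z < 0]) ->
  lowering_weight N i k k' = w :> int ->
  q ^+ lowering_weight N i k k' * qnat q (N i k') * det_coef (shift_unit N i k k') =
  (\prod_a \prod_b qfact (N a b)) *
  \sum_(j < m.+1) q ^ w * (qint ((N i k)%:Z + 1) * term m%:Z s r l t v j%:Z).
Proof.
move=> kk' Mw Me M0 wE; rewrite -2!mulr_sumr -/(six_sum s r l t v).
rewrite exprnP wE -mulrA [RHS]mulrCA; congr (_ * _).
have [N0|Np] := posnP (N i k').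
  have -> : six_sum s r l t v = 0; last by rewrite N0 qnat0 mul0r !mulr0.
  rewrite /six_sum big1 // => j _; apply: term_eq0.
  by have := M0 N0 j; case/or4P => [->|->|->|/orP[]->]; rewrite ?orbT.
rewrite /det_coef ifT; last by apply/forallP => b; rewrite Mw.
have [-> -> -> -> ->] := Me Np.
rewrite mulrA prod_qfact_move // -qint_nat (_ : (N i k).+1%:Z = (N i k)%:Z + 1); last by lia.
by rewrite -mulrA mulrCA.
Qed.

Lemma lowering_weight3 (N : 'M[nat]_3) (k k' : 'I_3) :
  [/\ lowering_weight N o0 k k' = (N o0 k + 2 * (N o1 k' + N o2 k'))%N,
      lowering_weight N o1 k k' = (N o0 k + N o0 k' + N o1 k + 2 * N o2 k')%N &
      lowering_weight N o2 k k' =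
        (N o0 k + N o0 k' + N o1 k + N o1 k' + N o2 k)%N].
Proof.
split; rewrite /lowering_weight big_mkcond big_ord3 [X in (2 * X)%N]big_mkcond big_ord3 /=; lia.
Qed.

Lemma det_coef_lowering01 (N : 'M[nat]_3) : row_sums m N ->
  \sum_i q ^+ lowering_weight N i o0 o1 * qnat q (N i o1) *
         det_coef (shift_unit N i o0 o1) = 0.
Proof.
move=> Nr.
have := Nr o0; have := Nr o1; have := Nr o2; rewrite !big_ord3 /= => r2 r1 r0.
(* Unless the shifted matrices have all column sums m, each term of the relation vanishes by
   itself. *)
have [C|nC] := boolP [&& N o0 o0 + N o1 o0 + N o2 o0 + 1 == m,
  N o0 o1 + N o1 o1 + N o2 o1 == m + 1 & N o0 o2 + N o1 o2 + N o2 o2 == m]%N;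
  last first.
  have Z i : qnat q (N i o1) * det_coef (shift_unit N i o0 o1) = 0.
    have [->|Np] := posnP (N i o1); first by rewrite qnat0 mul0r.
    rewrite /det_coef; case: ifP => [/forallP H|_]; last by rewrite mulr0.
    have := H o0; have := H o1; have := H o2; rewrite !big_ord3 !mxE /=.
    by move: i Np {H}; apply: ord3 => Np /=; lia.
  by rewrite -!mulrA !Z !mulr0 !addr0.
have [w0 w1 w2] := lowering_weight3 N o0 o1.
pose a := (N o0 o0)%:Z; pose r := (N o0 o2)%:Z; pose l := (N o2 o0)%:Z.
pose t := (N o2 o2)%:Z; pose v := a + l + r + t - m%:Z.
have /and3P[/eqP c0 /eqP c1 /eqP c2] := C.
rewrite (lowering_det_coef_term (s := a + 1) (r := r) (l := l) (t := t) (v := v + 1)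
   (w := a + 2 * (v + 1 + (m%:Z - l - t)))) //; first 1 last.
- by move=> Np; apply: ord3; rewrite big_ord3 !mxE /=; lia.
- by move=> Np; rewrite !mxE /= /v /a /r /l /t; split; lia.
- by move=> N0 j; rewrite /v /a /r /l /t; lia.
- by rewrite w0 /v /a /r /l /t; lia.
rewrite (lowering_det_coef_term (s := a) (r := r) (l := l) (t := t) (v := v)
   (w := a + (m%:Z - a - r) + (m%:Z - 1 - a - l) + 2 * (m%:Z - l - t))) //; first 1 last.
- by move=> Np; apply: ord3; rewrite big_ord3 !mxE /=; lia.
- by move=> Np; rewrite !mxE /= /v /a /r /l /t; split; lia.
- by move=> N0 j; rewrite /v /a /r /l /t; lia.
- by rewrite w1 /v /a /r /l /t; lia.
rewrite (lowering_det_coef_term (s := a) (r := r) (l := l + 1) (t := t) (v := v + 1)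
   (w := a + (m%:Z - a - r) + (m%:Z - 1 - a - l) + (v + 1) + l)) //; first 1 last.
- by move=> Np; apply: ord3; rewrite big_ord3 !mxE /=; lia.
- by move=> Np; rewrite !mxE /= /v /a /r /l /t; split; lia.
- by move=> N0 j; rewrite /v /a /r /l /t; lia.
- by rewrite w2 /v /a /r /l /t; lia.
rewrite -!mulrDr -!big_split /=.
have c10 : (N o1 o0)%:Z + 1 = m%:Z - a - l by rewrite /a /l; lia.
rewrite c10 [X in _ * X](eq_bigr _ (fun j _ => etrans (addrA _ _ _) (first_columns _ _ _ _ _ _))).
(* At both ends, j = -1 and j = m, some multiplicity is negative. *)
rewrite sum_telescope ?mulr0 // /first_boundary term_eq0 ?mulr0 //.
  by rewrite !orbT.
by rewrite /v /a /r /l /t; lia.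
Qed.

Lemma det_coef_lowering12 (N : 'M[nat]_3) : row_sums m N ->
  \sum_i q ^+ lowering_weight N i o1 o2 * qnat q (N i o2) *
         det_coef (shift_unit N i o1 o2) = 0.
Proof.
move=> Nr.
have := Nr o0; have := Nr o1; have := Nr o2; rewrite !big_ord3 /= => r2 r1 r0.
have [C|nC] := boolP [&& N o0 o0 + N o1 o0 + N o2 o0 == m,
  N o0 o1 + N o1 o1 + N o2 o1 + 1 == m & N o0 o2 + N o1 o2 + N o2 o2 == m + 1]%N;
  last first.
  have Z i : qnat q (N i o2) * det_coef (shift_unit N i o1 o2) = 0.
    have [->|Np] := posnP (N i o2); first by rewrite qnat0 mul0r.
    rewrite /det_coef; case: ifP => [/forallP H|_]; last by rewrite mulr0.
    have := H o0; have := H o1; have := H o2; rewrite !big_ord3 !mxE /=.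
    by move: i Np {H}; apply: ord3 => Np /=; lia.
  by rewrite -!mulrA !Z !mulr0 !addr0.
have [w0 w1 w2] := lowering_weight3 N o1 o2.
(* Here [r] and [t] are entries less one, possibly -1, which the integer identity [last_columns]
   allows. *)
pose s := (N o0 o0)%:Z; pose r := (N o0 o2)%:Z - 1; pose l := (N o2 o0)%:Z.
pose t := (N o2 o2)%:Z - 1; pose v := s + l + r + t + 1 - m%:Z.
have /and3P[/eqP c0 /eqP c1 /eqP c2] := C.
rewrite (lowering_det_coef_term (s := s) (r := r) (l := l) (t := t + 1) (v := v)
   (w := (m%:Z - s - r - 1) + 2 * ((m%:Z - r - t - 1) + (t + 1)))) //; first 1 last.
- by move=> Np; apply: ord3; rewrite big_ord3 !mxE /=; lia.
- by move=> Np; rewrite !mxE /= /v /s /r /l /t; split; lia.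
- by move=> N0 j; rewrite /v /s /r /l /t; lia.
- by rewrite w0 /v /s /r /l /t; lia.
rewrite (lowering_det_coef_term (s := s) (r := r + 1) (l := l) (t := t + 1) (v := v + 1)
   (w := (m%:Z - s - r - 1) + (r + 1) + v + 2 * (t + 1))) //; first 1 last.
- by move=> Np; apply: ord3; rewrite big_ord3 !mxE /=; lia.
- by move=> Np; rewrite !mxE /= /v /s /r /l /t; split; lia.
- by move=> N0 j; rewrite /v /s /r /l /t; lia.
- by rewrite w1 /v /s /r /l /t; lia.
rewrite (lowering_det_coef_term (s := s) (r := r + 1) (l := l) (t := t) (v := v)
   (w := (m%:Z - s - r - 1) + (r + 1) + v + (m%:Z - r - t - 1) + (m%:Z - l - t - 1))) //;
  first 1 last.
- by move=> Np; apply: ord3; rewrite big_ord3 !mxE /=; lia.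
- by move=> Np; rewrite !mxE /= /v /s /r /l /t; split; lia.
- by move=> N0 j; rewrite /v /s /r /l /t; lia.
- by rewrite w2 /v /s /r /l /t; lia.
rewrite -!mulrDr -!big_split /=.
have c01 : (N o0 o1)%:Z + 1 = m%:Z - s - r by rewrite /s /r; lia.
have c11 : (N o1 o1)%:Z + 1 = v + 1 by rewrite /v /s /r /l /t; lia.
have c21 : (N o2 o1)%:Z + 1 = m%:Z - l - t by rewrite /l /t; lia.
rewrite c01 c11 c21 [X in _ * X](eq_bigr _ (fun j _ => etrans (addrA _ _ _) (last_columns _ _ _ _ _ _))).
rewrite sum_telescope ?mulr0 // /last_boundary term_eq0 ?mulr0 //.
  by rewrite !orbT.
by rewrite /v /s /r /l /t; lia.
Qed.

Lemma det_coef_lowering (j j' : 'I_3) (N : 'M[nat]_3) : j' = j.+1 :> nat ->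
  row_sums m N ->
  \sum_i q ^+ lowering_weight N i j j' * qnat q (N i j') *
         det_coef (shift_unit N i j j') = 0.
Proof.
move: j j'; apply: ord3; apply: ord3 => //= _.
- exact: det_coef_lowering01.
- exact: det_coef_lowering12.
Qed.

End SixTermSum.

(** * Blocks along the antidiagonal *)

Section BlockEmbedding.
Variables (n i0 j0 m : nat).
Hypothesis ijn : (i0 + j0 + 3 = n)%N.

(** The condition [ijn] centres the block on the antidiagonal. Rows outside it are then 0 in its
    columns, so relations between those columns see only the block. *)
Definition block (N : 'M[nat]_3) : 'M[nat]_n :=
  \matrix_(a, b) if (i0 <= a < i0 + 3)%N && (j0 <= b < j0 + 3)%N
                 then N (inord (a - i0)) (inord (b - j0))
                 else antidiag n m a b.

Lemma block_row_subproof (k : 'I_3) : (i0 + k < n)%N.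
Proof. by have := ltn_ord k; lia. Qed.
Lemma block_col_subproof (k : 'I_3) : (j0 + k < n)%N.
Proof. by have := ltn_ord k; lia. Qed.
Definition block_row k : 'I_n := Ordinal (block_row_subproof k).
Definition block_col k : 'I_n := Ordinal (block_col_subproof k).

Lemma block_in N (k l : 'I_3) : block N (block_row k) (block_col l) = N k l.
Proof.
have := ltn_ord k; have := ltn_ord l => lk ll.
rewrite mxE /= !addKn !inord_val !leq_addr !ltn_add2l.
by rewrite lk ll.
Qed.

Lemma block_out_row (N : 'M[nat]_3) (a : 'I_n) (l : 'I_3) :
  ~~ (i0 <= a < i0 + 3)%N -> block N a (block_col l) = 0%N.
Proof.
move=> ai; rewrite mxE (negPf ai) /= mxE; case: eqP => // /(congr1 val) /= e.
by have := ltn_ord l; have := ltn_ord a; lia.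
Qed.

Lemma sum_block (V : nmodType) (P : pred 'I_n) (F : 'I_n -> V) :
  (forall a : 'I_n, ~~ (i0 <= a < i0 + 3)%N -> F a = 0) ->
  \sum_(a | P a) F a = \sum_(k : 'I_3 | P (block_row k)) F (block_row k).
Proof.
move=> F0; rewrite (bigID (fun a : 'I_n => i0 <= a < i0 + 3)%N) /=.
rewrite [X in _ + X]big1 => [|a /andP[_ /F0 //]]; rewrite addr0.
rewrite (reindex_onto block_row (fun a => inord (a - i0))) => [|a /andP[_ ai]] /=.
  apply: eq_bigl => k; rewrite addKn inord_val eqxx andbT leq_addr ltn_add2l.
  by rewrite ltn_ord !andbT.
by apply: val_inj; rewrite /= inordK; lia.
Qed.

Lemma block_lowering_weight (N : 'M[nat]_3) k j j' :
  lowering_weight (block N) (block_row k) (block_col j) (block_col j') =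
  lowering_weight N k j j'.
Proof.
rewrite /lowering_weight block_in; congr (_ + _ + 2 * _)%N.
  rewrite [LHS](sum_block (V := nat)) => [|a ai]; last by rewrite !block_out_row.
  by apply: eq_big => [a|a _] /=; rewrite ?ltn_add2l ?block_in.
rewrite [LHS](sum_block (V := nat)) => [|a ai]; last by rewrite !block_out_row.
by apply: eq_big => [a|a _] /=; rewrite ?ltn_add2l ?block_in.
Qed.

Lemma block_shift_unit (N : 'M[nat]_3) k j j' :
  shift_unit (block N) (block_row k) (block_col j) (block_col j') =
  block (shift_unit N k j j').
Proof.
apply/matrixP => a b; rewrite mxE !block_in.
have [/andP[ai bj]|] := boolP ((i0 <= a < i0 + 3) && (j0 <= b < j0 + 3))%N.
  have [k' ->] : exists k', a = block_row k'.
    by exists (inord (a - i0)); apply: val_inj; rewrite /= inordK; lia.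
  have [l' ->] : exists l', b = block_col l'.
    by exists (inord (b - j0)); apply: val_inj; rewrite /= inordK; lia.
  by rewrite !block_in mxE -!val_eqE /= !eqn_add2l.
move=> ab; rewrite [RHS]mxE (negPf ab) [block N (block_row k) b]mxE [block N a b]mxE (negPf ab).
move: ab; rewrite negb_and => /orP[ai|bj].
  by rewrite ifN //; apply: contra ai => /eqP -> /=; have := ltn_ord k; lia.
case: eqP => // ->; rewrite (negPf bj) andbF !ifN //.
- by apply: contra bj => /eqP -> /=; have := ltn_ord j'; lia.
- by apply: contra bj => /eqP -> /=; have := ltn_ord j; lia.
Qed.

Lemma block_antidiag : block (antidiag 3 m) = antidiag n m.
Proof.
apply/matrixP => a b; rewrite mxE; case: ifP => // /andP[ai bj].
rewrite !mxE -!val_eqE /= !inordK; try by lia.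
by congr (if _ then _ else _); have := ltn_ord a; lia.
Qed.

End BlockEmbedding.

Section BlockMonomial.

Lemma prod_nat_split3 (R : pzRingType) (H : nat -> R) n j : (j + 3 <= n)%N ->
  \prod_(0 <= b < n) H b =
  (\prod_(0 <= b < j) H b) * H j * H j.+1 * H j.+2 * \prod_(j + 3 <= b < n) H b.
Proof.
move=> jn; rewrite (@big_cat_nat _ _ _ j) //=; last by lia.
have E k : (k < n)%N -> \prod_(k <= b < n) H b = H k * \prod_(k.+1 <= b < n) H b.
  by move=> kn; rewrite big_ltn.
by rewrite 3?E ?mulrA ?addn3 //; lia.
Qed.

Lemma prod_nat1 (R : pzRingType) (H : nat -> R) n c : (c < n)%N ->
  (forall b, b != c -> H b = 1) -> \prod_(0 <= b < n) H b = H c.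
Proof.
move=> cn H1; rewrite (@big_cat_nat _ _ _ c) //=; last by lia.
rewrite [X in _ * X]big_ltn // big_nat big1 => [|b bc]; last by apply: H1; lia.
by rewrite big_nat big1 ?mul1r ?mulr1 // => b bc; apply: H1; lia.
Qed.

Definition expo (m s r l t : nat) : 'M[nat]_3 :=
  \matrix_(a, b) nth 0%N (nth [::]
    [:: [:: s; (m - s - r)%N; r];
        [:: (m - s - l)%N; (s + r + l + t - m)%N; (m - r - t)%N];
        [:: l; (m - l - t)%N; t]] a) b.

Variables (K : fieldType) (A : algType K) (n i0 j0 m s r l t : nat).
Variable X : nat -> nat -> A.
Hypothesis ijn : (i0 + j0 + 3 = n)%N.

(** The rows above, in and below the block give the three factors; a row outside is a single power
    on the antidiagonal. *)
Lemma mon_block :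
  mon (fun a b : 'I_n => X a.+1 b.+1) (block n i0 j0 m (expo m s r l t)) =
  (\prod_(1 <= u < i0.+1) X u (n + 1 - u)%N ^+ m) *
  mono9 (X i0.+1 j0.+1) (X i0.+1 j0.+2) (X i0.+1 j0.+3)
        (X i0.+2 j0.+1) (X i0.+2 j0.+2) (X i0.+2 j0.+3)
        (X i0.+3 j0.+1) (X i0.+3 j0.+2) (X i0.+3 j0.+3) m s r l t *
  (\prod_(i0.+1 + 3 <= u < n.+1) X u (n + 1 - u)%N ^+ m).
Proof.
pose N := expo m s r l t.
pose e a b := if (i0 <= a < i0 + 3)%N && (j0 <= b < j0 + 3)%N
  then N (inord (a - i0)) (inord (b - j0)) else if b == (n - a.+1)%N then m else 0%N.
pose G a := \prod_(0 <= b < n) X a.+1 b.+1 ^+ e a b.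
have -> : mon (fun a b : 'I_n => X a.+1 b.+1) (block n i0 j0 m N) =
    \prod_(0 <= a < n) G a.
  rewrite big_mkord; apply: eq_bigr => a _; rewrite /G big_mkord.
  apply: eq_bigr => b _; rewrite mxE /e; case: ifP => // _.
  by rewrite mxE -val_eqE.
have Gout a : (a < n)%N -> ~~ (i0 <= a < i0 + 3)%N ->
    G a = X a.+1 (n + 1 - a.+1)%N ^+ m.
  move=> an ai; rewrite /G (prod_nat1 (c := (n - a.+1)%N)) /e ?(negPf ai) /=.
  - by rewrite eqxx; congr (X _ _ ^+ m); lia.
  - by lia.
  - by move=> b /negPf ->.
have Gin k : (k < 3)%N -> G (i0 + k)%N =
    X (i0 + k).+1 j0.+1 ^+ N (inord k) (inord 0) *
    X (i0 + k).+1 j0.+2 ^+ N (inord k) (inord 1) *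
    X (i0 + k).+1 j0.+3 ^+ N (inord k) (inord 2).
  move=> k3; have ek c : (c < 3)%N -> e (i0 + k)%N (j0 + c)%N = N (inord k) (inord c).
    by move=> c3; rewrite /e !leq_addr !ltn_add2l k3 c3 !addKn.
  have e0 b : ~~ (j0 <= b < j0 + 3)%N -> e (i0 + k)%N b = 0%N.
    by move=> bj; rewrite /e (negPf bj) andbF; case: eqP => // -> in bj *; lia.
  rewrite /G (@prod_nat_split3 _ _ _ j0); last by lia.
  rewrite big_nat big1 ?mul1r => [|b bj]; last by rewrite e0 ?expr0 //; lia.
  rewrite [X in _ * X]big_nat big1 ?mulr1 => [|b bj]; last first.
    by rewrite e0 ?expr0 //; lia.
  by rewrite -!ek // addn0 addn1 addn2.


rewrite (@prod_nat_split3 _ _ _ i0); last by lia.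
have -> : \prod_(0 <= a < i0) G a = \prod_(1 <= u < i0.+1) X u (n + 1 - u)%N ^+ m.
  by rewrite big_add1 big_nat [RHS]big_nat; apply: eq_bigr => a ai; apply: Gout; lia.
have -> : \prod_(i0 + 3 <= a < n) G a =
    \prod_(i0.+1 + 3 <= u < n.+1) X u (n + 1 - u)%N ^+ m.
  rewrite addSn big_add1 big_nat [RHS]big_nat.
  by apply: eq_bigr => a ai; apply: Gout; lia.
move: (\prod_(1 <= u < i0.+1) _) (\prod_(i0.+1 + 3 <= u < n.+1) _) => u v.
rewrite -[in G i0](addn0 i0) -[in G i0.+1](addn1 i0) -[in G i0.+2](addn2 i0) !Gin //.
rewrite /N /expo !mxE !inordK //= !addn0 !addn1 !addn2.
by rewrite /mono9 !mulrA.
Qed.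

End BlockMonomial.

(** * Haar values and the closed formula *)

Section HaarValues.
Variables (K : fieldType) (q : K).
Hypothesis q0 : q != 0.
Hypothesis q_nroot : forall k, (0 < k)%N -> q ^+ k != 1.

Lemma qnat_neq0 k : qnat q k.+1 != 0.
Proof.
have nz : 1 - q ^+ 2 != 0 by rewrite subr_eq0 eq_sym q_nroot.
rewrite -(qint_nat q0 (q_nroot (ltn0Sn 1))) /qint mulf_neq0 ?invr_eq0 //.
by rewrite subr_eq0 eq_sym (_ : 2 * _ = (2 * k.+1)%N%:Z) -?exprnP ?q_nroot //; lia.
Qed.

Section Fixed.
Variables (n m : nat) (h : {scalar OGL n q}).
Hypothesis n1 : (1 < n)%N.
Hypothesis hP : is_haar h.
Local Notation x := (@OGL_x K n q).
Local Notation dinv := (OGL_detinv n q).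

(** Otherwise [psi_eq0] kills all monomials with row sums m, hence by [qdet_span] also the value at
    D_q^m times its inverse, which is h(1) = 1. *)
Lemma haar_antidiag_neq0 : h (mon x (antidiag n m) * dinv ^+ m) != 0.
Proof.
apply/negP => /eqP h0.
have z := psi_eq0 q0 qnat_neq0
  (fun j j' N jj' (_ : row_sums m N) => haar_lowering q0 jj' m N hP)
  (fun N k => haar_weight q0 n1 q_nroot hP) h0.
have : h (qdet q x ^+ m * dinv ^+ m) = 0.
  have Lin : linear_for *%R (fun u => h (u * dinv ^+ m)).
    by move=> c u v; rewrite mulrDl -scalerAl linearP.
  pose f : {scalar OGL n q} := HB.pack (fun u : OGL n q => h (u * dinv ^+ m))
    (GRing.isLinear.Build K (OGL n q) K *%R _ Lin).
  have sp := qdet_span q0 (@OGL_colE K q n) (@OGL_rowE K q n) (@OGL_antiE K q n)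
    (@OGL_diagE K q n) m.
  by apply: (lspan_eq0 (f := f)) sp => _ [N -> Nr]; exact: z.
have -> : qdet q x ^+ m * dinv ^+ m = 1.
  elim: m => [|k IH]; first by rewrite !expr0 mulr1.
  by rewrite exprSr exprS mulrA -(mulrA _ (qdet q x)) OGL_dinvE mulr1.
by rewrite (proj1 hP) => /eqP; rewrite oner_eq0.
Qed.

(** Both sides solve the 3 x 3 relations in [N] and agree at the antidiagonal, so uniqueness applies
    to their difference. *)
Lemma haar_block i0 j0 (N : 'M[nat]_3) : (i0 + j0 + 3 = n)%N -> row_sums m N ->
  h (mon x (block n i0 j0 m N) * dinv ^+ m) * det_coef q m (antidiag 3 m) =
  h (mon x (antidiag n m) * dinv ^+ m) * det_coef q m N.
Proof.
move=> ijn Nr.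
pose psi N := h (mon x (block n i0 j0 m N) * dinv ^+ m) * det_coef q m (antidiag 3 m) -
  h (mon x (antidiag n m) * dinv ^+ m) * det_coef q m N.
apply: subr0_eq; apply: (psi_eq0 (psi := psi) q0 qnat_neq0) Nr.
- move=> j j' M jj' Mr; rewrite /psi.
  transitivity ((\sum_k q ^+ lowering_weight M k j j' * qnat q (M k j') *
      h (mon x (block n i0 j0 m (shift_unit M k j j')) * dinv ^+ m)) *
      det_coef q m (antidiag 3 m) -
    h (mon x (antidiag n m) * dinv ^+ m) *
    (\sum_k q ^+ lowering_weight M k j j' * qnat q (M k j') * det_coef q m (shift_unit M k j j'))).
    rewrite mulr_suml mulr_sumr -sumrB; apply: eq_bigr => k _; ring.
  rewrite (det_coef_lowering q0 (q_nroot (ltn0Sn 1)) qnat_neq0) // mulr0 subr0.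
  have jj2 : block_col ijn j' = (block_col ijn j).+1 :> nat by rewrite /= jj' addnS.
  rewrite -[RHS](mul0r (det_coef q m (antidiag 3 m))); congr (_ * _).
  rewrite -[RHS](haar_lowering q0 jj2 m (block n i0 j0 m M) hP).
  rewrite [RHS](sum_block ijn) => [|a ai].
    by apply: eq_bigr => k _; rewrite block_shift_unit block_in block_lowering_weight.
  by rewrite block_out_row // qnat0 mulr0 mul0r.
- move=> M k Mk; rewrite /psi (det_coef_weight _ Mk) mulr0 subr0.
  rewrite (haar_weight q0 n1 q_nroot (k := block_col ijn k)) ?mul0r //.
  rewrite (sum_block ijn) => [|a ai]; last by rewrite block_out_row.
  by under eq_bigr do rewrite block_in.
- by rewrite /psi block_antidiag // subrr.
Qed.

(** The 1-based corner (i, n - 1 - i) becomes the 0-based offset (i - 1, n - 2 - i), which is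
    centred on the antidiagonal. *)
Lemma mononE i s r l t : (1 <= i <= n - 2)%N -> (3 <= n)%N ->
  monon q n i m s r l t =
  mon x (block n i.-1 (n - 2 - i) m (expo m s r l t)) * dinv ^+ m.
Proof.
move=> ib n3; have ijn : (i.-1 + (n - 2 - i) + 3 = n)%N by lia.
have -> : mon x = mon (fun a b : 'I_n => xgen n q a.+1 b.+1).
  apply/funext => N; apply: eq_bigr => a _; apply: eq_bigr => b _.
  by rewrite /xgen /= !valK.
rewrite (mon_block (K := K) m s r l t (xgen n q) ijn) /monon.
have -> : (n - 1 - i = (n - 2 - i).+1)%N by lia.
by case: i ib ijn.
Qed.

End Fixed.

Section ClosedForm.
Variables m s r l t : nat.
Hypothesis srm : (s + r <= m)%N.
Hypothesis slm : (s + l <= m)%N.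
Hypothesis rtm : (r + t <= m)%N.
Hypothesis ltm : (l + t <= m)%N.
Hypothesis msrlt : (m <= s + r + l + t)%N.

Lemma expo_row_sums : row_sums m (expo m s r l t).
Proof. by apply: ord3; rewrite big_ord3 !mxE /=; lia. Qed.

Lemma expo_col_sums k : (\sum_a expo m s r l t a k)%N = m.
Proof. by move: k; apply: ord3; rewrite big_ord3 !mxE /=; lia. Qed.

End ClosedForm.

Lemma expo_antidiag m : expo m 0 m m 0 = antidiag 3 m.
Proof.
by apply/matrixP; apply: ord3; apply: ord3; rewrite !mxE /= ?subnn ?subn0 //; lia.
Qed.

(** Only j = m survives, with ceg of multiplicity m: three factorials from the entries against one
    inverse factorial. *)
Lemma det_coef_antidiag m : det_coef q m (antidiag 3 m) = qfact q m ^+ 2.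
Proof.
rewrite -expo_antidiag /det_coef ifT; last first.
  by apply/forallP => k; rewrite expo_col_sums //; lia.
rewrite !big_ord3 /= !mxE /= !subn0 !subnn !addn0 !add0n !addnK.
have qf0 : qfact q 0 = 1 by rewrite /qfact big_ord0.
rewrite qf0 !(mul1r, mulr1) /six_sum big_ord_recr /= big1 => [|j _]; last first.
  by apply: term_eq0; have := ltn_ord j; lia.
have if0 : invfact q 0 = 1 by rewrite /invfact /= qf0 invr1.
rewrite add0r /term /invfact6 !subrr !add0r addNr.
have -> : term_exp m%:Z 0 m%:Z m%:Z 0 m%:Z m%:Z = 0 by rewrite /term_exp; ring.
have -> : (-1) ^ (m%:Z + m%:Z + m%:Z + m%:Z) = 1 :> K.
  rewrite (_ : _ + _ = 2 * (m%:Z + m%:Z)); last by ring.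
  by rewrite -exprz_exp (_ : (-1) ^ 2 = 1) ?exp1rz // -exprnP sqrrN expr1n.
by rewrite expr0z if0 !mul1r /invfact; field; exact: (qfact_neq0 qnat_neq0).
Qed.

Lemma qpochE k : qpoch (q ^+ 2) (q ^+ 2) k = (1 - q ^+ 2) ^+ k * qfact q k.
Proof.
elim: k => [|k IH]; first by rewrite /qpoch /qfact !big_ord0 mulr1.
have E : qnat q k.+1 * (1 - q ^+ 2) = 1 - q ^+ 2 * q ^+ 2 ^+ k.
  rewrite -(qint_nat q0 (q_nroot (ltn0Sn 1))) /qint divfK; last first.
    by rewrite subr_eq0 eq_sym q_nroot.
  by rewrite -exprS -exprM.
rewrite qfactS /qpoch big_ord_recr /= -/(qpoch _ _ k) IH -E [_ ^+ k.+1]exprS; ring.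
Qed.

(** The powers of 1 - q^2 cancel, and for b > a the zero of [invfact] reproduces the convention for
    binomials. *)
Lemma qbin2E a b : qbin2 q a b = qfact q a * invfact q b * invfact q (a%:Z - b%:Z).
Proof.
have nz : 1 - q ^+ 2 != 0 by rewrite subr_eq0 eq_sym q_nroot.
have fz := qfact_neq0 qnat_neq0.
rewrite /qbin2; case: leqP => ab; last first.
  by rewrite [invfact q (_ - _)]invfact_lt0 ?mulr0 //; lia.
rewrite (_ : a%:Z - b%:Z = (a - b)%N%:Z); last by lia.
rewrite !qpochE /invfact -{1}(subnKC ab) exprD.
by field; rewrite !fz !expf_neq0.
Qed.

Lemma qmultinom2E a b c d : (b + c + d = a)%N ->
  qmultinom2 q a b c d = qfact q a / (qfact q b * qfact q c * qfact q d).
Proof.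
have nz : 1 - q ^+ 2 != 0 by rewrite subr_eq0 eq_sym q_nroot.
have fz := qfact_neq0 qnat_neq0.
move=> <-; rewrite /qmultinom2 !qpochE !exprD.
by field; rewrite !fz !expf_neq0.
Qed.

Section Ratio.
Variables m s r l t : nat.
Hypothesis srm : (s + r <= m)%N.
Hypothesis slm : (s + l <= m)%N.
Hypothesis rtm : (r + t <= m)%N.
Hypothesis ltm : (l + t <= m)%N.
Hypothesis msrlt : (m <= s + r + l + t)%N.

Lemma det_coef_ratio : let nu := (s + r + l + t - m)%N in
  det_coef q m (expo m s r l t) / det_coef q m (antidiag 3 m) =
    (\sum_(0 <= j < nu.+1)
       (-1) ^+ j *
       q ^ ((nu%:Z - j%:Z) * (nu%:Z - 3 * j%:Z - 1) + 2 * j%:Z * (s%:Z + t%:Z)) *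
       (qbin2 q r j * qbin2 q l j * qbin2 q s (nu - j) * qbin2 q t (nu - j) /
        qbin2 q nu j)) *
    ((-1) ^+ (r + l + nu) *
     q ^ ((2 * m%:Z + 1) * (l%:Z + r%:Z) + (nu%:Z - 2) * m%:Z
          - 2 * l%:Z ^+ 2 - 2 * r%:Z ^+ 2 - r%:Z * l%:Z + 4 * s%:Z * t%:Z
          - 3 * nu%:Z * s%:Z - 3 * nu%:Z * t%:Z) /
     (qmultinom2 q m nu (m - l - s) (m - r - t) *
      qmultinom2 q m nu (m - r - s) (m - l - t))).
Proof.
move=> nu; have fz := qfact_neq0 qnat_neq0.
rewrite det_coef_antidiag !qmultinom2E; try by rewrite /nu; lia.
rewrite /det_coef ifT; last by apply/forallP => k; rewrite expo_col_sums.
rewrite !big_ord3 /= !mxE /= -/nu.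
(* For nu < j <= m the multiplicity nu - j of aek is negative. *)
have -> : six_sum q m s r l t nu =
    \sum_(0 <= j < nu.+1) term q m%:Z s%:Z r%:Z l%:Z t%:Z nu%:Z j%:Z.
  rewrite /six_sum -(big_mkord xpredT (fun j : nat => term q m s r l t nu j)).
  rewrite (@big_cat_nat _ _ _ nu.+1) //=; last by rewrite /nu; lia.
  rewrite [X in _ + X](_ : _ = 0) ?addr0 //.
  by rewrite big_nat big1 // => j jnu; apply: term_eq0; lia.
(* The sums agree term by term: powers of q and signs match, which leaves an identity of
   q-factorials. *)
rewrite mulrAC mulr_sumr !mulr_suml big_nat [RHS]big_nat; apply: eq_bigr => j jnu.
have jn : (j <= nu)%N by lia.
rewrite !qbin2E /term /term_exp (expfzDr (_ + _) _ q0).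
move: (q ^ _) (q ^ _) => X Y.
have -> : (-1) ^ (j%:Z + r%:Z + l%:Z + nu%:Z) = (-1) ^+ j * (-1) ^+ (r + l + nu) :> K.
  by rewrite -exprD exprnP; congr (_ ^ _); lia.
rewrite (_ : (nu - j)%N%:Z = nu%:Z - j%:Z); last by lia.
rewrite /invfact6 !opprB !addrA -[s%:Z + _ - _]addrAC -[t%:Z + _ - _]addrAC.
rewrite [(m - l - s)%N]subnAC [(m - r - s)%N]subnAC.
rewrite (_ : nu%:Z - j%:Z = (nu - j)%N%:Z); last by lia.
move: (invfact q (s%:Z - _ + _)) (invfact q (t%:Z - _ + _)) => a b.
move: (invfact q (r%:Z - _)) (invfact q (l%:Z - _)) ((-1) ^+ (_ + _)) ((-1) ^+ j) => c d f e.
rewrite /invfact; field.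
by rewrite !fz.
Qed.
End Ratio.
Lemma haar_ratio n i m s r l t (h : {scalar OGL n q}) :
  (3 <= n)%N -> (1 <= i <= n - 2)%N ->
  (s + r <= m)%N -> (s + l <= m)%N -> (r + t <= m)%N -> (l + t <= m)%N ->
  (m <= s + r + l + t)%N -> is_haar h ->
  h (monon q n i m s r l t) / h (monon q n i m 0 m m 0) =
  det_coef q m (expo m s r l t) / det_coef q m (antidiag 3 m).
Proof.
move=> n3 ib srm slm rtm ltm msrlt hP.
have n1 : (1 < n)%N by lia.
have ijn : (i.-1 + (n - 2 - i) + 3 = n)%N by lia.
rewrite !mononE // expo_antidiag block_antidiag //.
have D0 : det_coef q m (antidiag 3 m) != 0.
  by rewrite det_coef_antidiag expf_neq0 ?qfact_neq0 //; exact: qnat_neq0.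
apply/eqP; rewrite eqr_div ?haar_antidiag_neq0 //; apply/eqP.
by rewrite haar_block 1?mulrC //; apply: expo_row_sums.
Qed.

Lemma mono3E m s r l t : mono3 q m s r l t = monon q 3 1 m s r l t.
Proof. by rewrite /monon !big_geq // mul1r mulr1. Qed.

End HaarValues.

Local Open Scope complex_scope.

Theorem corollary4p2 (R : realType) (q : R) (n i m s r l t : nat)
    (hn : {scalar OGL n q%:C}) (h3 : {scalar OGL 3 q%:C}) :
  q != 0 -> q != 1 -> q != -1 ->
  (3 <= n)%N -> (1 <= i <= n - 2)%N ->
  (s + r <= m)%N -> (s + l <= m)%N -> (r + t <= m)%N -> (l + t <= m)%N ->
  (m <= s + r + l + t)%N ->
  is_haar hn -> is_haar h3 ->
  let Q : R[i] := q%:C in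
  let nu := (s + r + l + t - m)%N in
  hn (monon Q n i m s r l t) / hn (monon Q n i m 0 m m 0) =
    h3 (mono3 Q m s r l t) / h3 (mono3 Q m 0 m m 0) /\
  h3 (mono3 Q m s r l t) / h3 (mono3 Q m 0 m m 0) =
    (\sum_(0 <= j < nu.+1)
       (-1) ^+ j *
       Q ^ ((nu%:Z - j%:Z) * (nu%:Z - 3 * j%:Z - 1) + 2 * j%:Z * (s%:Z + t%:Z)) *
       (qbin2 Q r j * qbin2 Q l j * qbin2 Q s (nu - j) * qbin2 Q t (nu - j) /
        qbin2 Q nu j)) *
    ((-1) ^+ (r + l + nu) *
     Q ^ ((2 * m%:Z + 1) * (l%:Z + r%:Z) + (nu%:Z - 2) * m%:Z
          - 2 * l%:Z ^+ 2 - 2 * r%:Z ^+ 2 - r%:Z * l%:Z + 4 * s%:Z * t%:Z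
          - 3 * nu%:Z * s%:Z - 3 * nu%:Z * t%:Z) /
     (qmultinom2 Q m nu (m - l - s) (m - r - t) *
      qmultinom2 Q m nu (m - r - s) (m - l - t))).
Proof.
move=> q0 q1 qN1 n3 ib srm slm rtm ltm msrlt hnP h3P Q nu.
have Q0 : Q != 0 by rewrite /Q fmorph_eq0.
(* Reality of [q] enters here: q^k = 1 gives |q| = 1, hence q = 1 or q = -1. *)
have Q_nroot k : (0 < k)%N -> Q ^+ k != 1.
  move=> k0; rewrite /Q -rmorphXn /= fmorph_eq1.
  apply/eqP => /(congr1 Num.norm); rewrite normrX normr1 => /eqP.
  rewrite pexpr_eq1 ?normr_ge0 // => nq1.
  by have := eqr_norml q 1; rewrite nq1 (negPf q1) (negPf qN1).
have i3 : (1 <= 1 <= 3 - 2)%N by [].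
(* Both ratios become the same ratio of [det_coef], the 3 x 3 case being n = 3, i = 1. *)
rewrite !mono3E !(haar_ratio Q0 Q_nroot) //.
by split=> //; rewrite det_coef_ratio.
Qed.
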